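(* Let $R$ be a commutative ring, $S$ a module-finite $R$-algebra, $M$ a direct summand of a direct sum of finitely presented right $S$-modules, and $N$ a finitely presented right $S$-module. Suppose that $Y:=\operatorname{Max}(R)\cap\operatorname{Supp}_R(N)$ is Noetherian with $\dim(Y)<\infty$. Then the following statements hold: (1) Let $t$ be a positive integer, and suppose that $\operatorname{spl}_{S_{\mathfrak m}}(M_{\mathfrak m},N_{\mathfrak m})\geqslant t+\dim(Y)$ for every $\mathfrak m\in Y$. Then $\operatorname{spl}_S(M,N)\geqslant t$. (2) $\operatorname{spl}_S(M,N)=\infty$ if and only if $\operatorname{spl}_{S_{\mathfrak m}}(M_{\mathfrak m},N_{\mathfrak m})=\infty$ for every $\mathfrak m\in Y$. (3) Suppose that $\operatorname{spl}_{S_{\mathfrak n}}(M_{\mathfrak n},N_{\mathfrak n})<\infty$ for some $\mathfrak n\in Y$. Then \[\operatorname{spl}_S(M,N)\geqslant \min\{\operatorname{spl}_{S_{\mathfrak m}}(M_{\mathfrak m},N_{\mathfrak m}):\mathfrak m\in Y\}-\dim(Y).\]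
   Context: Every ring has a $1$ and every module is unital; $S$ need not be commutative. A module-finite $R$-algebra is an $R$-algebra that is finitely generated as an $R$-module; right $S$-modules are viewed as $R$-modules in the natural way, and for $\mathfrak p\in\operatorname{Spec}(R)$, $M_{\mathfrak p}$, $N_{\mathfrak p}$, $S_{\mathfrak p}$ denote localizations at $R-\mathfrak p$. For an algebra $S$ over a commutative ring and right $S$-modules $M,N$, $\operatorname{spl}_S(M,N)$ denotes the supremum (possibly $\infty$) of the nonnegative integers $t$ such that there exists a split surjective $S$-linear map from $M$ to $N^{\oplus t}$ (i.e. a surjection having an $S$-linear right inverse). $\operatorname{Max}(R)$ is the set of maximal ideals of $R$ and $\operatorname{Supp}_R(N)=\{\mathfrak p\in\operatorname{Spec}(R):N_{\mathfrak p}\neq0\}$. Every subset $Y$ of $\operatorname{Spec}(R)$ carries the subspace topology induced by the Zariski topology; ''Noetherian'' means Noetherian as a topological space, and $\dim(Y)$ is the Krull dimension of $Y$ as a topological space, with $\dim(\varnothing)=-\infty$. *)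

(* Defs.v *)
From HB Require Import structures.
From mathcomp Require Import all_boot all_order all_algebra.
From mathcomp Require Import generic_quotient.
From mathcomp Require Import ring.
From mathcomp Require Import all_classical constructive_ereal.
From mathcomp Require Import topology.

Set Implicit Arguments.
Unset Strict Implicit.
Unset Printing Implicit Defensive.

Import Order.TTheory GRing.Theory Num.Theory.

Local Open Scope classical_set_scope.
Local Open Scope ring_scope.
Local Open Scope quotient_scope.

(* The library's algType excludes the zero ring, which is allowed here both
   for R and for S; an R-algebra structure on S is therefore given by a ring
   morphism from R to the centre of S. *)
Record algStr (R : comPzRingType) (S : pzRingType) := AlgStr {
  alg_map :> {rmorphism R -> S};
  alg_central : forall (r : R) (s : S), alg_map r * s = s * alg_map r
}.

(* A right S-module is a left module over the converse ring S^c, with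
   s *: x standing for the product of x by s on the right. *)
Notation rmodType S := (lmodType (S^c)%type).

Section ScalarRestriction.
Variables (R : comPzRingType) (S : pzRingType) (phi : algStr R S).

(* phi is a phantom parameter of the next two types, on which the R-module
   structures declared below depend. *)
Definition algMod : Type := let _ := phi in S.
HB.instance Definition _ := GRing.Zmodule.copy algMod S.

Definition alg_scale (r : R) (s : algMod) : algMod := phi r * (s : S).

Fact alg_scaleA a b s : alg_scale a (alg_scale b s) = alg_scale (a * b) s.
Proof. by rewrite /alg_scale rmorphM mulrA. Qed.
Fact alg_scale1 : left_id 1 alg_scale.
Proof. by move=> s; rewrite /alg_scale rmorph1 mul1r. Qed.
Fact alg_scaleDr : right_distributive alg_scale +%R.
Proof. by move=> a s t; rewrite /alg_scale -mulrDr. Qed.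
Fact alg_scaleDl s : {morph alg_scale^~ s : a b / a + b}.
Proof. by move=> a b; rewrite /alg_scale rmorphD mulrDl. Qed.
HB.instance Definition _ := GRing.Zmodule_isLmodule.Build R algMod
  alg_scaleA alg_scale1 alg_scaleDr alg_scaleDl.

Definition restr (M : rmodType S) : Type := let _ := phi in M.
HB.instance Definition _ (M : rmodType S) := GRing.Zmodule.copy (restr M) M.

Section Restr.
Variable M : rmodType S.

Definition restr_scale (r : R) (x : restr M) : restr M :=
  (phi r : S^c) *: (x : M).

Fact restr_scaleA a b x :
  restr_scale a (restr_scale b x) = restr_scale (a * b) x.
Proof.
rewrite /restr_scale scalerA; congr (_ *: _).
by rewrite rmorphM /= alg_central.
Qed.
Fact restr_scale1 : left_id 1 restr_scale.
Proof. by move=> x; rewrite /restr_scale rmorph1; exact: scale1r. Qed.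
Fact restr_scaleDr : right_distributive restr_scale +%R.
Proof. by move=> a x y; rewrite /restr_scale -scalerDr. Qed.
Fact restr_scaleDl x : {morph restr_scale^~ x : a b / a + b}.
Proof. by move=> a b; rewrite /restr_scale rmorphD; exact: scalerDl. Qed.
HB.instance Definition _ := GRing.Zmodule_isLmodule.Build R (restr M)
  restr_scaleA restr_scale1 restr_scaleDr restr_scaleDl.

End Restr.
End ScalarRestriction.

Section Finiteness.
Variable A : pzRingType.

Definition finitely_generated (V : lmodType A) : Prop :=
  exists (n : nat) (e : 'I_n -> V),
    forall v, exists c : 'I_n -> A, v = \sum_(i < n) c i *: e i.

(* an exact sequence A^m -> A^n -> V -> 0 *)
Definition finitely_presented (V : lmodType A) : Prop :=
  exists (m n : nat) (g : {linear 'rV[A]_m -> 'rV[A]_n})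
         (f : {linear 'rV[A]_n -> V}),
    (forall v, exists x, f x = v) /\
    (forall x, f x = 0 <-> exists y, g y = x).

Definition direct_summand (V W : lmodType A) : Prop :=
  exists (V' : lmodType A) (f : {linear W -> (V * V')%type}), bijective f.

End Finiteness.

Section DirectSum.
Variables (A : pzRingType) (I : Type) (F : I -> lmodType A).

Record dsum : Type := Dsum {
  dsum_val :> forall i, F i;
  dsum_fin : finite_set [set i | dsum_val i != 0]
}.

Lemma dsumP (f g : dsum) : (forall i, f i = g i) -> f = g.
Proof.
case: f g => [f ff] [g fg] /= e.
have {}e : f = g by exact: functional_extensionality_dep.
by subst g; congr Dsum; exact: Prop_irrelevance.
Qed.

HB.instance Definition _ := gen_eqMixin dsum.
HB.instance Definition _ := gen_choiceMixin dsum.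

Fact dsum0_subproof : finite_set [set i | (0 : F i) != 0].
Proof.
by apply: (@sub_finite_set _ _ set0) => [i /=|]; [rewrite eqxx|].
Qed.
Definition dsum0 : dsum := Dsum dsum0_subproof.

Fact dsumN_subproof (f : dsum) : finite_set [set i | - f i != 0].
Proof.
by apply: (sub_finite_set _ (dsum_fin f)) => i /=; rewrite oppr_eq0.
Qed.
Definition dsumN (f : dsum) : dsum := Dsum (dsumN_subproof f).

Fact dsumD_subproof (f g : dsum) : finite_set [set i | f i + g i != 0].
Proof.
apply: (@sub_finite_set _ _ ([set i | f i != 0] `|` [set i | g i != 0])).
  move=> i /= fg0; apply: contrapT => /not_orP[/negP + /negP].
  by rewrite !negbK => /eqP f0 /eqP g0; move: fg0; rewrite f0 g0 addr0 eqxx.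
by rewrite finite_setU; split; exact: dsum_fin.
Qed.
Definition dsumD (f g : dsum) : dsum := Dsum (dsumD_subproof f g).

Fact dsumA : associative dsumD.
Proof. by move=> f g h; apply: dsumP => i /=; exact: addrA. Qed.
Fact dsumC : commutative dsumD.
Proof. by move=> f g; apply: dsumP => i /=; exact: addrC. Qed.
Fact dsum0D : left_id dsum0 dsumD.
Proof. by move=> f; apply: dsumP => i /=; exact: add0r. Qed.
Fact dsumND : left_inverse dsum0 dsumN dsumD.
Proof. by move=> f; apply: dsumP => i /=; exact: addNr. Qed.
HB.instance Definition _ :=
  GRing.isZmodule.Build dsum dsumA dsumC dsum0D dsumND.

Fact dsumZ_subproof (a : A) (f : dsum) :
  finite_set [set i | a *: f i != 0].
Proof.
apply: (sub_finite_set _ (dsum_fin f)) => i /=.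
by apply: contra => /eqP->; rewrite scaler0.
Qed.
Definition dsumZ (a : A) (f : dsum) : dsum := Dsum (dsumZ_subproof a f).

Fact dsumZA a b f : dsumZ a (dsumZ b f) = dsumZ (a * b) f.
Proof. by apply: dsumP => i /=; exact: scalerA. Qed.
Fact dsumZ1 : left_id 1 dsumZ.
Proof. by move=> f; apply: dsumP => i /=; exact: scale1r. Qed.
Fact dsumZDr : right_distributive dsumZ +%R.
Proof. by move=> a f g; apply: dsumP => i /=; exact: scalerDr. Qed.
Fact dsumZDl f : {morph dsumZ^~ f : a b / a + b}.
Proof. by move=> a b; apply: dsumP => i /=; exact: scalerDl. Qed.
HB.instance Definition _ := GRing.Zmodule_isLmodule.Build A dsum
  dsumZA dsumZ1 dsumZDr dsumZDl.

End DirectSum.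

Definition split_surjective (A : pzRingType) (V W : lmodType A)
    (f : {linear V -> W}) : Prop :=
  (forall w, exists v, f v = w) /\
  exists g : {linear W -> V}, forall w, f (g w) = w.

(* Every subset of \bar int has a supremum and an infimum, so that the default
   value in supremum and infimum is only used for set0. Here the set always
   contains t = 0. *)
Definition spl (A : pzRingType) (V W : lmodType A) : \bar int :=
  supremum -oo%E [set t%:Z%:E | t in [set t : nat |
    exists f : {linear V -> {ffun 'I_t -> W}}, split_surjective f]].

Section Ideals.
Variable R : comPzRingType.

Definition is_ideal (I : set R) : Prop :=
  [/\ I 0, (forall x y, I x -> I y -> I (x + y)) &
      (forall a x, I x -> I (a * x))].

Definition is_prime_ideal (p : set R) : Prop :=
  [/\ is_ideal p, ~ p 1 & forall x y, p (x * y) -> p x \/ p y].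

Definition is_maximal_ideal (m : set R) : Prop :=
  [/\ is_ideal m, ~ m 1 &
      forall I : set R, is_ideal I -> ~ I 1 -> m `<=` I -> I = m].

End Ideals.

Record Spec (R : comPzRingType) := MkSpec {
  spec_set :> set R;
  spec_prime : is_prime_ideal spec_set
}.

HB.instance Definition _ (R : comPzRingType) := gen_eqMixin (Spec R).
HB.instance Definition _ (R : comPzRingType) := gen_choiceMixin (Spec R).

Section Zariski.
Variable R : comPzRingType.

Definition zariski_V (E : set R) : set (Spec R) := [set p | E `<=` p].

Definition zariski_open : set_system (Spec R) :=
  [set U | exists E : set R, U = ~` zariski_V E].

Fact zariski_openT : zariski_open setT.
Proof.
exists setT; apply/esym; rewrite -subTset => p _ pT.
by case: (spec_prime p) => _ + _; apply; apply: pT.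
Qed.

Fact zariski_openI : setI_closed zariski_open.
Proof.
move=> _ _ [E ->] [F ->]; exists [set x * y | x in E & y in F].
rewrite -setCU; congr (~` _); apply/seteqP; split => p /=.
  have [[_ _ pM] _ _] := spec_prime p.
  by case=> [Ep|Fp] _ [x Ex [y Fy <-]]; [rewrite mulrC|]; apply: pM;
    [exact: Ep|exact: Fp].
move=> EFp; apply: contrapT => /not_orP[].
move=> /existsNP[x /not_implyP[Ex px]] /existsNP[y /not_implyP[Fy py]].
have [_ _ prp] := spec_prime p.
have /prp[] // : spec_set p (x * y) by apply: EFp; exists x => //; exists y.
Qed.

Fact zariski_open_bigU (I : Type) (f : I -> set (Spec R)) :
  (forall i, zariski_open (f i)) -> zariski_open (\bigcup_i f i).
Proof.
move=> /choice[E fE]; exists (\bigcup_i E i).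
apply/seteqP; split => p /=.
  move=> [i _]; rewrite fE => /= + Ep; apply => x Ex.
  by apply: Ep; exists i.
move=> /existsNP[x /not_implyP[[i _ Ex] px]]; exists i => //.
by rewrite fE => /= Ep; apply: px; apply: Ep.
Qed.

HB.instance Definition _ := isOpenTopological.Build (Spec R)
  zariski_openT zariski_openI zariski_open_bigU.

Definition Max : set (Spec R) := [set m | is_maximal_ideal m].

End Zariski.
Arguments Max R : clear implicits.

Section Localization.
Variables (R : comPzRingType) (p : Spec R).

Record denom : Type := Denom {
  den : R;
  denomP : ~ spec_set p den
}.
HB.instance Definition _ := gen_eqMixin denom.
HB.instance Definition _ := gen_choiceMixin denom.

Fact denom1_subproof : ~ spec_set p 1.
Proof. by case: (spec_prime p). Qed.
Definition denom1 : denom := Denom denom1_subproof.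

Fact denomM_subproof (u v : denom) : ~ spec_set p (den u * den v).
Proof.
have [_ _ prp] := spec_prime p.
by move=> /prp[]; exact: denomP.
Qed.
Definition denomM (u v : denom) : denom := Denom (@denomM_subproof u v).

Section LocModule.
Variable M : lmodType R.

Definition loc_rel (a b : M * denom) : bool :=
  `[< exists w : denom,
      den w *: (den b.2 *: a.1) = den w *: (den a.2 *: b.1) >].

Fact loc_rel_refl : reflexive loc_rel.
Proof. by move=> a; apply/asboolP; exists denom1. Qed.

Fact loc_rel_sym : symmetric loc_rel.
Proof.
by move=> a b; apply/asboolP/asboolP => -[w e]; exists w; rewrite e.
Qed.

Fact loc_rel_trans : transitive loc_rel.
Proof.
move=> [y v] [x u] [z w] /asboolP[/= s e] /asboolP[/= t e'].
apply/asboolP; exists (denomM (denomM s t) v) => /=.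
move: e => /(congr1 (fun q => (den t * den w) *: q)); rewrite !scalerA => e.
move: e' => /(congr1 (fun q => (den s * den u) *: q)); rewrite !scalerA => e'.
transitivity ((den t * den w * den s * den v) *: x).
  by congr (_ *: _); ring.
rewrite e; transitivity ((den s * den u * den t * den w) *: y).
  by congr (_ *: _); ring.
by rewrite e'; congr (_ *: _); ring.
Qed.

Canonical loc_equiv := EquivRel loc_rel loc_rel_refl loc_rel_sym loc_rel_trans.

Definition loc : Type := {eq_quot loc_rel}.
HB.instance Definition _ := Choice.on loc.

Definition frac (x : M) (u : denom) : loc := \pi_({eq_quot loc_rel}) (x, u).

Lemma frac_eq x u y v : frac x u = frac y v <->
  exists w : denom, den w *: (den v *: x) = den w *: (den u *: y).
Proof.
by split=> [/eqmodP/asboolP //|e]; apply/eqmodP/asboolP.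
Qed.

Lemma fracP (a : loc) : exists x u, a = frac x u.
Proof.
by exists (repr a).1, (repr a).2; rewrite /frac -surjective_pairing reprK.
Qed.

Definition loc_rec T (f : M -> denom -> T) (a : loc) : T :=
  f (repr a).1 (repr a).2.

Lemma loc_recE T (f : M -> denom -> T) x u :
  (forall x u y v, frac x u = frac y v -> f x u = f y v) ->
  loc_rec f (frac x u) = f x u.
Proof. by apply; rewrite /frac -surjective_pairing reprK. Qed.

Definition loc0 : loc := frac 0 denom1.

Definition loc_opp (a : loc) : loc := loc_rec (fun x u => frac (- x) u) a.

Definition loc_add (a b : loc) : loc :=
  loc_rec (fun x u => loc_rec (fun y v =>
    frac (den v *: x + den u *: y) (denomM u v)) b) a.

Lemma loc_oppE x u : loc_opp (frac x u) = frac (- x) u.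
Proof.
apply: loc_recE => {}x {}u y v /frac_eq[w e]; apply/frac_eq; exists w.
by rewrite !scalerN e.
Qed.

Lemma loc_addE x u y v : loc_add (frac x u) (frac y v) =
  frac (den v *: x + den u *: y) (denomM u v).
Proof.
have addr_wd x1 u1 y1 v1 y2 v2 : frac y1 v1 = frac y2 v2 ->
    frac (den v1 *: x1 + den u1 *: y1) (denomM u1 v1) =
    frac (den v2 *: x1 + den u1 *: y2) (denomM u1 v2).
  move=> /frac_eq[w e]; apply/frac_eq; exists w => /=.
  move: e => /(congr1 (fun q => (den u1 * den u1) *: q)).
  rewrite !scalerDr !scalerA => e; congr (_ + _).
    by congr (_ *: _); ring.
  transitivity ((den u1 * den u1 * den w * den v2) *: y1).
    by congr (_ *: _); ring.
  by rewrite e; congr (_ *: _); ring.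
have recE x1 u1 : loc_rec (fun y v =>
    frac (den v *: x1 + den u1 *: y) (denomM u1 v)) (frac y v) =
    frac (den v *: x1 + den u1 *: y) (denomM u1 v).
  by apply: loc_recE => *; exact: addr_wd.
have fracC x1 u1 : frac (den v *: x1 + den u1 *: y) (denomM u1 v) =
    frac (den u1 *: y + den v *: x1) (denomM v u1).
  by apply/frac_eq; exists denom1 => /=; rewrite addrC (mulrC (den v)).
rewrite /loc_add loc_recE ?recE// => x1 u1 x2 u2 e.
by rewrite !recE !fracC; exact: addr_wd.
Qed.

Fact loc_addA : associative loc_add.
Proof.
move=> a b c.
have [x [u ->]] := fracP a; have [y [v ->]] := fracP b.
have [z [w ->]] := fracP c; rewrite !loc_addE /=.
apply/frac_eq; exists denom1 => /=; rewrite !scalerDr !scalerA addrA.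
by congr (_ *: _ + _ *: _ + _ *: _); ring.
Qed.

Fact loc_addC : commutative loc_add.
Proof.
move=> a b; have [x [u ->]] := fracP a; have [y [v ->]] := fracP b.
rewrite !loc_addE; apply/frac_eq; exists denom1 => /=.
by rewrite addrC (mulrC (den v)).
Qed.

Fact loc_add0 : left_id loc0 loc_add.
Proof.
move=> a; have [x [u ->]] := fracP a; rewrite loc_addE.
apply/frac_eq; exists denom1 => /=; rewrite scaler0 add0r !scalerA.
by congr (_ *: _); ring.
Qed.

Fact loc_addN : left_inverse loc0 loc_opp loc_add.
Proof.
move=> a; have [x [u ->]] := fracP a; rewrite loc_oppE loc_addE.
apply/frac_eq; exists denom1 => /=.
by rewrite scalerN addNr !scaler0.
Qed.

HB.instance Definition _ := GRing.isZmodule.Build loc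
  loc_addA loc_addC loc_add0 loc_addN.

End LocModule.
End Localization.

Section LocAlgebra.
Variables (R : comPzRingType) (S : pzRingType) (phi : algStr R S).
Variable p : Spec R.

Definition locRing : Type := loc p (algMod phi).
HB.instance Definition _ := GRing.Zmodule.on locRing.

Definition sfrac (s : S) (u : denom p) : locRing := frac (s : algMod phi) u.

Lemma sfrac_eq s u t v : sfrac s u = sfrac t v <->
  exists w : denom p, phi (den w * den v) * s = phi (den w * den u) * t.
Proof.
by rewrite /sfrac frac_eq; split=> -[w e]; exists w; move: e;
  rewrite !scalerA.
Qed.

Lemma sfracP (a : locRing) : exists s u, a = sfrac s u.
Proof.
have [s [u e]] := @fracP _ p (algMod phi) a.
by exists s, u.
Qed.

Lemma sfracD s u t v :
  sfrac s u + sfrac t v =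
  sfrac (phi (den v) * s + phi (den u) * t) (denomM u v).
Proof. exact: loc_addE. Qed.

Local Notation srec := (@loc_rec R p (algMod phi) _).

Definition loc1 : locRing := sfrac 1 (denom1 p).

Definition loc_mul (a b : locRing) : locRing :=
  srec (fun s u => srec (fun t v =>
    sfrac ((s : S) * (t : S)) (denomM u v)) b) a.

Lemma loc_mulE s u t v :
  loc_mul (sfrac s u) (sfrac t v) = sfrac (s * t) (denomM u v).
Proof.
have wdr s1 u1 t1 v1 t2 v2 : sfrac t1 v1 = sfrac t2 v2 ->
    sfrac (s1 * t1) (denomM u1 v1) = sfrac (s1 * t2) (denomM u1 v2).
  move=> /sfrac_eq[w e]; apply/sfrac_eq; exists w => /=.
  have swap (r : R) t' : phi (den w * (den u1 * r)) * (s1 * t') =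
      phi (den u1) * s1 * (phi (den w * r) * t').
    rewrite [_ * s1]alg_central mulrA -!mulrA [in RHS](mulrA (phi (den u1))).
    rewrite -(rmorphM (alg_map phi)).
    by rewrite !mulrA -alg_central; congr (phi _ * _ * _); ring.
  by rewrite !swap e.
have wdl t1 v1 s1 u1 s2 u2 : sfrac s1 u1 = sfrac s2 u2 ->
    sfrac (s1 * t1) (denomM u1 v1) = sfrac (s2 * t1) (denomM u2 v1).
  move=> /sfrac_eq[w e]; apply/sfrac_eq; exists w => /=.
  have swap (r : R) s' : phi (den w * (r * den v1)) * (s' * t1) =
      phi (den v1) * (phi (den w * r) * s') * t1.
    by rewrite !mulrA -(rmorphM (alg_map phi)); congr (phi _ * _ * _); ring.
  by rewrite !swap e.
have recE s1 u1 : srec (fun t v =>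
    sfrac ((s1 : S) * (t : S)) (denomM u1 v)) (sfrac t v) =
    sfrac (s1 * t) (denomM u1 v).
  by apply: loc_recE => *; exact: wdr.
rewrite /loc_mul [LHS]loc_recE ?recE// => s1 u1 s2 u2 e.
by rewrite !recE; exact: wdl.
Qed.

Fact loc_mulA : associative loc_mul.
Proof.
move=> a b c.
have [x [u ->]] := sfracP a; have [y [v ->]] := sfracP b.
have [z [w ->]] := sfracP c; rewrite !loc_mulE mulrA.
by apply/sfrac_eq; exists (denom1 p) => /=; rewrite !mulrA.
Qed.

Fact loc_mul1l : left_id loc1 loc_mul.
Proof.
move=> a; have [x [u ->]] := sfracP a; rewrite loc_mulE mul1r.
by apply/sfrac_eq; exists (denom1 p) => /=; rewrite !mul1r.
Qed.

Fact loc_mul1r : right_id loc1 loc_mul.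
Proof.
move=> a; have [x [u ->]] := sfracP a; rewrite loc_mulE mulr1.
by apply/sfrac_eq; exists (denom1 p) => /=; rewrite mulr1.
Qed.

Fact loc_mulDl : left_distributive loc_mul +%R.
Proof.
move=> a b c.
have [x [u ->]] := sfracP a; have [y [v ->]] := sfracP b.
have [z [w ->]] := sfracP c; rewrite sfracD !loc_mulE sfracD.
apply/sfrac_eq; exists (denom1 p) => /=.
rewrite !mulrDl !mulrDr !mulrA -!(rmorphM (alg_map phi)).
by congr (phi _ * _ * _ + phi _ * _ * _); ring.
Qed.

Fact loc_mulDr : right_distributive loc_mul +%R.
Proof.
move=> a b c.
have [x [u ->]] := sfracP a; have [y [v ->]] := sfracP b.
have [z [w ->]] := sfracP c; rewrite sfracD !loc_mulE sfracD.
apply/sfrac_eq; exists (denom1 p) => /=.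
have sw r t : x * (phi r * t) = phi r * (x * t).
  by rewrite mulrA -alg_central mulrA.
rewrite [x * _]mulrDr !sw !mulrDr !mulrA -!(rmorphM (alg_map phi)).
by congr (phi _ * _ * _ + phi _ * _ * _); ring.
Qed.

HB.instance Definition _ := GRing.Zmodule_isPzRing.Build locRing
  loc_mulA loc_mul1l loc_mul1r loc_mulDl loc_mulDr.

Section LocModuleOverLocRing.
Variable M : rmodType S.

Definition locMod : Type := loc p (restr phi M).
HB.instance Definition _ := GRing.Zmodule.on locMod.

Definition mfrac (x : M) (u : denom p) : locMod := frac (x : restr phi M) u.

Lemma mfrac_eq x u y v : mfrac x u = mfrac y v <->
  exists w : denom p,
    (phi (den w * den v) : S^c) *: x = (phi (den w * den u) : S^c) *: y.
Proof.
by rewrite /mfrac frac_eq; split=> -[w e]; exists w; move: e;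
  rewrite !scalerA.
Qed.

Lemma mfracP (a : locMod) : exists x u, a = mfrac x u.
Proof.
have [x [u e]] := @fracP _ p (restr phi M) a.
by exists x, u.
Qed.

Lemma mfracD x u y v : mfrac x u + mfrac y v =
  mfrac ((phi (den v) : S^c) *: x + (phi (den u) : S^c) *: y) (denomM u v).
Proof. exact: loc_addE. Qed.

Local Notation mrec := (@loc_rec R p (restr phi M) _).

Definition loc_scale (a : locRing^c) (b : locMod) : locMod :=
  srec (fun s u => mrec (fun x v =>
    mfrac ((s : S^c) *: (x : M)) (denomM u v)) b) (a : locRing).

Let scale_central (r : R) (s : S^c) (x : M) :
  (phi r : S^c) *: (s *: x) = s *: ((phi r : S^c) *: x).
Proof.
by rewrite !scalerA; congr (_ *: _); exact: (esym (alg_central phi r s)).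
Qed.

Let scale_phiM (a b : R) (x : M) :
  (phi (a * b) : S^c) *: x = (phi a : S^c) *: ((phi b : S^c) *: x).
Proof. by rewrite scalerA mulrC rmorphM. Qed.

Lemma loc_scaleE s u x v :
  loc_scale (sfrac s u) (mfrac x v) = mfrac ((s : S^c) *: x) (denomM u v).
Proof.
have wdr s1 u1 x1 v1 x2 v2 : mfrac x1 v1 = mfrac x2 v2 ->
    mfrac ((s1 : S^c) *: x1) (denomM u1 v1) =
    mfrac ((s1 : S^c) *: x2) (denomM u1 v2).
  move=> /mfrac_eq[w e]; apply/mfrac_eq; exists w => /=.
  have swap (r : R) (x' : M) :
      (phi (den w * (den u1 * r)) : S^c) *: ((s1 : S^c) *: x') =
      (s1 : S^c) *: ((phi (den u1) : S^c) *: ((phi (den w * r) : S^c) *: x')).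
    rewrite scale_central -scale_phiM; congr (_ *: (_ *: _)).
    by congr (phi _); ring.
  by rewrite !swap e.
have wdl x1 v1 s1 u1 s2 u2 : sfrac s1 u1 = sfrac s2 u2 ->
    mfrac ((s1 : S^c) *: x1) (denomM u1 v1) =
    mfrac ((s2 : S^c) *: x1) (denomM u2 v1).
  move=> /sfrac_eq[w e]; apply/mfrac_eq; exists w => /=.
  have swap (r : R) s' :
      (phi (den w * (r * den v1)) : S^c) *: ((s' : S^c) *: x1) =
      (phi (den v1) : S^c) *: ((phi (den w * r) * s' : S^c) *: x1).
    transitivity ((phi (den v1 * (den w * r)) : S^c) *: ((s' : S^c) *: x1)).
      by congr ((phi _ : S^c) *: _); ring.
    rewrite scale_phiM; congr (_ *: _); rewrite scalerA.
    by congr (_ *: _); exact: (esym (alg_central phi _ _)).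
  by rewrite !swap e.
have recE s1 u1 : mrec (fun x v =>
    mfrac ((s1 : S^c) *: (x : M)) (denomM u1 v)) (mfrac x v) =
    mfrac ((s1 : S^c) *: x) (denomM u1 v).
  by apply: loc_recE => *; exact: wdr.
rewrite /loc_scale [LHS]loc_recE ?recE// => s1 u1 s2 u2 e.
by rewrite !recE; exact: wdl.
Qed.

Fact loc_scaleA a b x : loc_scale a (loc_scale b x) = loc_scale (a * b) x.
Proof.
have [s [u ->]] := sfracP a; have [t [v ->]] := sfracP b.
have [y [w ->]] := mfracP x; rewrite (loc_scaleE t v) (loc_scaleE s u).
transitivity (loc_scale (sfrac (t * s) (denomM v u)) (mfrac y w)); last first.
  by congr (loc_scale _ _); exact: (esym (loc_mulE t v s u)).
rewrite (loc_scaleE (t * s)) scalerA; apply/mfrac_eq; exists (denom1 p) => /=.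
by congr ((phi _ : S^c) *: _); ring.
Qed.

Fact loc_scale1 : left_id (1 : locRing^c) loc_scale.
Proof.
move=> x; have [y [w ->]] := mfracP x.
rewrite [LHS]loc_scaleE [1 *: y]scale1r.
by apply/mfrac_eq; exists (denom1 p) => /=; rewrite !mul1r.
Qed.

Fact loc_scaleDr : right_distributive loc_scale +%R.
Proof.
move=> a x y; have [s [u ->]] := sfracP a.
have [x' [v ->]] := mfracP x; have [y' [w ->]] := mfracP y.
rewrite mfracD !loc_scaleE mfracD.
apply/mfrac_eq; exists (denom1 p) => /=.
rewrite !scalerDr -!(scale_central _ s) -!scale_phiM.
by congr ((phi _ : S^c) *: _ + (phi _ : S^c) *: _); ring.
Qed.

Fact loc_scaleDl x : {morph loc_scale^~ x : a b / a + b}.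
Proof.
move=> a b; have [s [u ->]] := sfracP a; have [t [v ->]] := sfracP b.
have [y [w ->]] := mfracP x.
transitivity (loc_scale
    (sfrac (phi (den v) * s + phi (den u) * t) (denomM u v)) (mfrac y w)).
  by congr (loc_scale _ _); exact: sfracD.
rewrite (loc_scaleE (_ + _)) (loc_scaleE s u) (loc_scaleE t v) mfracD.
apply/mfrac_eq; exists (denom1 p) => /=.
have -> : ((phi (den v) * s + phi (den u) * t : S) : S^c) *: y =
    (phi (den v) : S^c) *: ((s : S^c) *: y) +
    (phi (den u) : S^c) *: ((t : S^c) *: y).
  rewrite !scalerA -scalerDl; congr (_ *: _).
  by rewrite !alg_central.
rewrite !scalerDr -!scale_phiM.
by congr ((phi _ : S^c) *: _ + (phi _ : S^c) *: _); ring.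
Qed.

HB.instance Definition _ :=
  GRing.Zmodule_isLmodule.Build (locRing^c)%type locMod
    loc_scaleA loc_scale1 loc_scaleDr loc_scaleDl.

End LocModuleOverLocRing.
End LocAlgebra.

Definition Supp (R : comPzRingType) (M : lmodType R) : set (Spec R) :=
  [set p | exists x : loc p M, x != 0].

Section NoetherianDimension.
Variable T : topologicalType.

Definition noetherian_space : Prop :=
  forall F : nat -> set T,
    (forall n, closed (F n)) -> (forall n, F n.+1 `<=` F n) ->
    exists n, forall m, (n <= m)%N -> F m = F n.

Definition irreducible_set (Z : set T) : Prop :=
  Z !=set0 /\
  forall F G : set T, closed F -> closed G ->
    Z `<=` F `|` G -> Z `<=` F \/ Z `<=` G.

Definition closed_chain (n : nat) (Z : nat -> set T) : Prop :=
  (forall i, (i <= n)%N -> closed (Z i) /\ irreducible_set (Z i)) /\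
  (forall i, (i < n)%N -> Z i `<` Z i.+1).

(* -oo when T is empty, as there is then no chain at all *)
Definition krull_dim : \bar int :=
  supremum -oo%E [set n%:Z%:E | n in [set n | exists Z, closed_chain n Z]].

End NoetherianDimension.

(* Main.v *)
From HB Require Import structures.
Require Import Defs.
From mathcomp Require Import all_boot all_order all_algebra.
From mathcomp Require Import generic_quotient ring_quotient.
From mathcomp Require Import all_classical constructive_ereal topology.

(* With E = End_S(N), split surjections M -> N^t are pairs of families
   f_i : M -> N, g_j : N -> M whose composition matrix over E is the identity.
   Finite presentation turns local splittings at m into global families whose
   composition matrix is r 1 with r outside m, and since Y is quasi-compact,
   finitely many such families can be merged into one matrix X over E which at
   every m in Y has "rank" at least t + dim Y: some C X D equals r 1 with r
   outside m. It remains to compress X to t rows while keeping rank t at every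
   m in Y, and this is done by Eisenbud and Evans' reduction: replacing the
   rows x_i by x_i + a_i x, where x is the last row, lowers the ranks by at
   most one, and if the a_i are chosen well at one point of each irreducible
   component of the rank loci (the Chinese remainder theorem), then the
   dimension of each of these loci is kept under control. Locally everything
   rests on the stable range 1 property of the localizations of matrix rings
   over E, which act faithfully on finitely generated R-modules; modulo m it is
   proved in the image of the ring in a matrix algebra over R / m, after a
   semisimplification. *)

Set Implicit Arguments.
Unset Strict Implicit.
Unset Printing Implicit Defensive.

Import Order.TTheory GRing.Theory Num.Theory.

Local Open Scope classical_set_scope.
Local Open Scope ring_scope.
Local Open Scope quotient_scope.

(** * Maximal ideals and residue fields *)

Section MaximalIdeals.
Variables (R : comPzRingType) (m : set R).
Hypothesis maxm : is_maximal_ideal m.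

Lemma maximal_ideal_comaximal (I : set R) :
  is_ideal I -> ~ (I `<=` m) -> exists x y, [/\ m x, I y & x + y = 1].
Proof.
case: maxm => -[m0 mD mM] m1 mmax [I0 ID IM] nIm.
apply: contrapT => nxy; apply: nIm.
(* If 1 is not in J = m + I, then J is a proper ideal containing m, so J = m by maximality. *)
pose J : set R := [set z | exists x y, [/\ m x, I y & x + y = z]].
have JE : J = m.
  apply: mmax.
  - split.
    + by exists 0, 0; rewrite addr0.
    + move=> _ _ [x [y [mx Iy <-]]] [x' [y' [mx' Iy' <-]]].
      by exists (x + x'), (y + y'); rewrite addrACA; split; auto.
    + move=> a _ [x [y [mx Iy <-]]].
      by exists (a * x), (a * y); rewrite mulrDr; split; auto.
  - by move=> [x [y h]]; apply: nxy; exists x, y.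
  - by move=> x mx; exists x, 0; rewrite addr0.
by move=> y Iy; rewrite -JE; exists 0, y; rewrite add0r.
Qed.

Lemma maximal_ideal_invertible x : ~ m x -> exists y, m (1 - y * x).
Proof.
move=> nmx; pose I : set R := [set z | exists y, z = y * x].
have [|Im|u [_ [mu [y ->] uy1]]] := @maximal_ideal_comaximal I.
- split; first by exists 0; rewrite mul0r.
  + by move=> _ _ [y ->] [z ->]; exists (y + z); rewrite mulrDl.
  + by move=> a _ [y ->]; exists (a * y); rewrite mulrA.
- by apply: nmx; apply: Im; exists 1; rewrite mul1r.
- by exists y; rewrite -uy1 addrK.
Qed.

Lemma maximal_ideal_prime : is_prime_ideal m.
Proof.
case: maxm => -[m0 mD mM] m1 _; split=> // x y mxy.
apply: contrapT => /not_orP[/maximal_ideal_invertible[z mz] ny]; apply: ny.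
have -> : y = z * (x * y) + y * (1 - z * x).
  by rewrite mulrBr mulr1 [y * (z * x)]mulrC -mulrA addrC subrK.
by auto.
Qed.

End MaximalIdeals.

Section ResidueFieldNz.
Variables (R : comNzRingType) (m : set R).
Hypothesis maxm : is_maximal_ideal m.

Let mP : {pred R} := fun x => `[< m x >].

Fact residue_idealr_closed : idealr_closed mP.
Proof.
case: maxm => -[m0 mD mM] m1 _; split; first exact/asboolP.
  exact/asboolP.
by move=> a u v /asboolP mu /asboolP mv; apply/asboolP/mD => //; exact: mM.
Qed.
HB.instance Definition _ := isIdealr.Build R mP residue_idealr_closed.

Local Notation k := {ideal_quot mP}.

Let residue_eq0 (x : R) : (\pi_k x == 0) = (x \in mP).
Proof. by rewrite -[x in RHS]subr0 Quotient.idealrBE rmorph0. Qed.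

(** The second clause fixes the value 0 at 0, so that one choice function satisfies both field
    axioms on inverses. *)
Fact residue_inv_ex (x : k) : exists y : k, (x != 0 -> y * x = 1) /\ (x = 0 -> y = 0).
Proof.
have [->|x0] := eqVneq x 0; first by exists 0; split.
have : ~ m (repr x).
  by move=> mx; case/negP: x0; rewrite -[x]reprK residue_eq0; exact/asboolP.
move=> /(maximal_ideal_invertible maxm)[y my]; exists (\pi_k y); split=> [_|/eqP]; last by rewrite (negPf x0).
apply/eqP; rewrite eq_sym -subr_eq0 -[x]reprK -rmorphM.
rewrite -[X in X - _](rmorph1 (\pi_k : {rmorphism R -> k})) -rmorphB residue_eq0.
exact/asboolP.
Qed.

Definition residue_inv (x : k) : k := projT1 (cid (residue_inv_ex x)).

Fact residue_mulVf (x : k) : x != 0 -> residue_inv x * x = 1.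
Proof. by rewrite /residue_inv; case: cid => y []. Qed.
Fact residue_inv0 : residue_inv 0 = 0.
Proof. by rewrite /residue_inv; case: cid => y [_ h] /=; exact: h. Qed.

Definition residue_field : fieldType :=
  HB.pack k (GRing.ComNzRing_isField.Build k residue_mulVf residue_inv0).

Lemma residue_field_nz : exists (F : fieldType) (f : {rmorphism R -> F}),
  (forall y, exists x, f x = y) /\ (forall x, f x = 0 <-> m x).
Proof.
exists residue_field, (\pi_k : {rmorphism R -> k}); split=> [y|x].
  by exists (repr (y : k)); exact: reprK.
by split=> [/eqP|mx]; [rewrite residue_eq0 => /asboolP|];
  last (apply/eqP; rewrite residue_eq0; exact/asboolP).
Qed.

End ResidueFieldNz.

(** A maximal ideal omits 1, so [R] is nonzero and can be repacked as a nontrivial ring. *)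
Lemma residue_field_ex (R : comPzRingType) (m : set R) :
  is_maximal_ideal m ->
  exists (F : fieldType) (f : {rmorphism R -> F}),
    (forall y, exists x, f x = y) /\ (forall x, f x = 0 <-> m x).
Proof.
move=> maxm; have R1 : 1 != 0 :> R.
  apply/eqP => e; case: (maxm) => -[m0 _ _] m1 _; apply: m1.
  by rewrite e.
pose R' : comNzRingType := HB.pack R (GRing.PzSemiRing_isNonZero.Build R R1).
exact: (@residue_field_nz R' m maxm).
Qed.

(** * Stable range 1 for matrix algebras over a field *)

Section MatrixRepresentations.
Variables (F : fieldType) (K : Type) (chi : K -> F).
Variables (B : pzRingType) (kap : K -> B).

(** Representations over a residue field: [chi] will be reduction modulo a maximal ideal and [kap]
    the structure map of an algebra. *)
Definition mx_hom n (tau : B -> 'M[F]_n) : Prop :=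
  [/\ {morph tau : x y / x + y}, {morph tau : x y / x * y >-> x *m y},
      tau 1 = 1%:M & forall c, tau (kap c) = (chi c)%:M].

(** A weak form of semisimplicity: for a representation [tau], the matrix [tau (b * q)] fixes a
    nonzero vector, so no nonzero right ideal of the image is nil. *)
Definition mx_nondegenerate n (tau : B -> 'M[F]_n) : Prop :=
  forall b, tau b != 0 ->
    exists q (v : 'rV_n), v != 0 /\ v *m tau b *m tau q = v.

Lemma mx_hom0 n (tau : B -> 'M[F]_n) : mx_hom tau -> tau 0 = 0.
Proof.
by case=> tauD _ _ _; apply: (addrI (tau 0)); rewrite -tauD !addr0.
Qed.

Hypothesis chi_surj : forall y, exists x, chi x = y.

(** The orbit of [v] is closed under addition, and under scalars since these come from [kap] by
    surjectivity of [chi]. A matrix of maximal rank with rows in the orbit therefore spans it. *)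
Lemma mx_hom_orbit_span n (tau : B -> 'M[F]_n) (v : 'rV_n) :
  mx_hom tau ->
  exists r (U : 'M[F]_(r, n)), forall w, (w <= U)%MS <-> exists b, v *m tau b = w.
Proof.
move=> /[dup] tauh [tauD tauM tau1 tauK].
pose P r := `[< exists k (U : 'M[F]_(k, n)),
   (forall i, exists b, v *m tau b = row i U) /\ \rank U = r >].
have exP : exists r, P r.
  exists 0%N; apply/asboolP; exists 0%N, 0; split; first by case.
  exact: mxrank0.
have boundP r : P r -> (r <= n)%N.
  by move=> /asboolP[k [U [_ <-]]]; exact: rank_leq_col.
case: (ex_maxnP exP boundP) => r /asboolP[k [U [UP Ur]]] rmax.
exists k, U => w; split=> [/submxP[c ->]|[b <-]].
  have [f fE] := choice UP; have [g gE] := choice chi_surj.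
  exists (\sum_i kap (g (c 0 i)) * f i).
  have -> : tau (\sum_i kap (g (c 0 i)) * f i) = \sum_i c 0 i *: tau (f i).
    elim/big_rec2: _ => [|i x y _ <-]; first exact: mx_hom0.
    by rewrite tauD tauM tauK gE mul_scalar_mx.
  rewrite mulmx_sumr (mulmx_sum_row c); apply: eq_bigr => i _.
  by rewrite -scalemxAr fE.
have : P (\rank (col_mx U (v *m tau b))).
  apply/asboolP; exists (k + 1)%N, (col_mx U (v *m tau b)); split=> // i.
  case: (split_ordP i) => j ->; first by rewrite rowKu.
  by exists b; rewrite rowKd [j]ord1 row_id.
move=> /rmax; rewrite -Ur => rle.
have sU : (U <= col_mx U (v *m tau b))%MS by rewrite -addsmxE addsmxSl.
have : (col_mx U (v *m tau b) <= U)%MS by rewrite -(geq_leqif (mxrank_leqif_sup sU)).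
by rewrite -addsmxE addsmx_sub => /andP[].
Qed.

(* Semisimplification: replacing the row space by the direct sum of its
   composition factors. *)
Lemma mx_hom_semisimplify n (tau : B -> 'M[F]_n) : mx_hom tau ->
  exists n' (sig : B -> 'M[F]_n'),
    [/\ mx_hom sig, mx_nondegenerate sig &
        forall b, sig b \in unitmx -> tau b \in unitmx].
Proof.
elim/ltn_ind: n tau => n IH tau /[dup] tauh [tauD tauM tau1 tauK].
have [irr|/existsNP[v /not_implyP[v0 /existsNP[w /forallNP nw]]]] :=
    pselect (forall v : 'rV_n, v != 0 -> forall w, exists b, v *m tau b = w).
  (* Irreducible case: some basis vector has a nonzero image under [tau b], and this image can be
     carried back to the vector. *)
  exists n, tau; split=> // b tb0.
  have /existsP[i ri] : [exists i, row i (tau b) != 0].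
    apply: contraNT tb0 => /existsPn tb0; apply/eqP/row_matrixP => i.
    by rewrite row0; apply/eqP; move: (tb0 i); rewrite negbK.
  have [q qE] := irr _ ri (delta_mx 0 i).
  exists q, (delta_mx 0 i); split; last by rewrite -rowE qE.
  by apply: contraNneq ri => d0; rewrite rowE d0 mul0mx.
have [r [U UE]] := mx_hom_orbit_span v tauh.
have vU : (v <= U)%MS by apply/UE; exists 1; rewrite tau1 mulmx1.
have wU : ~~ (w <= U)%MS by apply/negP => /UE[b]; exact: nw.
have Ust b : (U *m tau b <= U)%MS.
  apply/row_subP => i; rewrite row_mul.
  have /UE[c <-] := row_sub i U.
  by apply/UE; exists (c * b); rewrite tauM mulmxA.
(* [U] spans a proper nonzero invariant subspace. [U1] is a basis of it, [Q] the projection onto the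
   quotient, [L] a section of [Q]; [s1] and [s2] below are the induced representations on the
   subspace and on the quotient. *)
pose U1 := row_base U; pose Q := col_base (cokermx U).
pose L := pinvmx Q.
have U1st b : (U1 *m tau b <= U1)%MS.
  by rewrite !eq_row_base (eqmxMr _ (eq_row_base U)).
have U1f : row_free U1 by exact: row_base_free.
have U1P : U1 *m pinvmx U1 = 1%:M by exact: mulmxVp.
have QP : L *m Q = 1%:M by apply: mulVpmx; exact: col_base_full.
have UQ : U *m Q = 0.
  have : U *m cokermx U = 0 by exact: mulmx_coker.
  rewrite -{1}(mulmx_base (cokermx U)) mulmxA => /(congr1 (mulmx^~ (pinvmx (row_base (cokermx U))))).
  by rewrite -mulmxA mulmxVp ?row_base_free// mulmx1 mul0mx.
have kerQ k (x : 'M_(k, n)) : x *m Q = 0 -> (x <= U1)%MS.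
  move=> xQ; rewrite eq_row_base submxE -(mulmx_base (cokermx U)) mulmxA.
  by rewrite -/Q xQ mul0mx.
have U1Q : U1 *m Q = 0.
  have /submxP[D ->] : (U1 <= U)%MS by rewrite eq_row_base.
  by rewrite -mulmxA UQ mulmx0.
pose P1 := pinvmx U1.
have s1E0 b : U1 *m tau b *m P1 *m U1 = U1 *m tau b by exact: mulmxKpV.
have {}U1P : U1 *m P1 = 1%:M by [].
clearbody P1 L; clearbody Q U1.
pose s1 b := U1 *m tau b *m P1.
pose s2 b := L *m tau b *m Q.
have s1E b : U1 *m tau b = s1 b *m U1 by rewrite /s1 s1E0.
have s2E b : tau b *m Q = Q *m s2 b.
  apply/eqP; rewrite -subr_eq0 /s2 !mulmxA -mulmxBl.
  have -> : tau b - Q *m L *m tau b = (1%:M - Q *m L) *m tau b.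
    by rewrite mulmxBl mul1mx.
  have /submxP[D ->] : (1%:M - Q *m L <= U1)%MS.
    by apply: kerQ; rewrite mulmxBl mul1mx -mulmxA QP mulmx1 subrr.
  by rewrite -(mulmxA D) s1E -!mulmxA U1Q !mulmx0.
have s1h : mx_hom s1.
  split.
  - by move=> x y; rewrite /s1 tauD mulmxDr mulmxDl.
  - by move=> x y; rewrite /s1 tauM !mulmxA s1E0.
  - by rewrite /s1 tau1 mulmx1.
  - by move=> c; rewrite /s1 tauK mul_mx_scalar -scalemxAl U1P scalemx1.
have s2h : mx_hom s2.
  split.
  - by move=> x y; rewrite /s2 tauD mulmxDr mulmxDl.
  - by move=> x y; rewrite [LHS]/s2 tauM mulmxA -mulmxA s2E mulmxA.
  - by rewrite /s2 tau1 mulmx1.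
  - by move=> c; rewrite /s2 tauK mul_mx_scalar -scalemxAl QP scalemx1.
have rU0 : (0 < \rank U)%N.
  rewrite lt0n mxrank_eq0; apply: contraNneq v0 => U0.
  by case/submxP: vU => D ->; rewrite U0 mulmx0.
have rUn : (\rank U < n)%N.
  by rewrite ltn_neqAle rank_leq_col andbT; apply: contra wU => /eqP rUn;
    apply: submx_full; rewrite /row_full rUn.
have rQ : (\rank (cokermx U) < n)%N.
  by rewrite mxrank_coker ltn_subrL rU0 (leq_trans _ rUn).
have [n1 [sg1 [[sg1D sg1M sg11 sg1K] sg1nd sg1u]]] := IH _ rUn s1 s1h.
have [n2 [sg2 [[sg2D sg2M sg21 sg2K] sg2nd sg2u]]] := IH _ rQ s2 s2h.
exists (n1 + n2)%N, (fun b => block_mx (sg1 b) 0 0 (sg2 b)); split.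
- split.
  + by move=> x y; rewrite add_block_mx !addr0 sg1D sg2D.
  + by move=> x y; rewrite mulmx_block !mul0mx !mulmx0 !addr0 add0r sg1M sg2M.
  + by rewrite sg11 sg21 -scalar_mx_block.
  + by move=> c; rewrite sg1K sg2K -scalar_mx_block.
- move=> b b0; have [z1|z1] := eqVneq (sg1 b) 0; last first.
    have [q [u [u0 uE]]] := sg1nd b z1.
    exists q, (row_mx u 0); split; last first.
      by rewrite !(mul_row_block, mul0mx, mulmx0, addr0, add0r) uE.
    by rewrite row_mx_eq0 negb_and u0 ?orbT.
  have [z2|z2] := eqVneq (sg2 b) 0.
    by move: b0; rewrite z1 z2 block_mx0 eqxx.
  have [q [u [u0 uE]]] := sg2nd b z2.
  exists q, (row_mx 0 u); split; last first.
    by rewrite !(mul_row_block, mul0mx, mulmx0, addr0, add0r) uE.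
  by rewrite row_mx_eq0 negb_and u0 ?orbT.
(* A vector killed by [tau b] dies in the quotient, hence lies in the span of [U1], where it is zero
   as well. *)
- move=> b; rewrite unitmxE det_ublock unitrM -!unitmxE => /andP[/sg1u u1 /sg2u u2].
  rewrite -row_free_unit -kermx_eq0 -submx0.
  set x := kermx _; have xb : x *m tau b = 0 by exact: mulmx_ker.
  have : x *m Q = 0.
    apply: (can_inj (mulmxK u2)); rewrite mul0mx -mulmxA -s2E mulmxA xb.
    by rewrite mul0mx.
  move=> /kerQ/submxP[y xE].
  have : y = 0.
    apply: (can_inj (mulmxK u1)); rewrite mul0mx.
    have : y *m s1 b *m U1 = 0 by rewrite -mulmxA -s1E mulmxA -xE xb.
    move=> /(congr1 (mulmx^~ P1)).
    by rewrite -mulmxA U1P mulmx1 mul0mx.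
  by rewrite xE => ->; rewrite mul0mx submx0.
Qed.

End MatrixRepresentations.

(** The column space of [x] lies in that of [y]; equal ranks would make them coincide and give
    [d']. *)
Lemma mxrank_lt_mulmxr (F : fieldType) n (x y d : 'M[F]_n) :
  x = y *m d -> ~ (exists d', y = x *m d') -> (\rank x < \rank y)%N.
Proof.
move=> xE nd; rewrite -(mxrank_tr x) -(mxrank_tr y); apply: rank_ltmx.
rewrite ltmxE xE trmx_mul submxMl /=; apply/negP => /submxP[D yD]; apply: nd.
by exists D^T; apply: trmx_inj; rewrite xE !trmx_mul trmxK.
Qed.

Section StableRange.
Variables (F : fieldType) (K : Type) (chi : K -> F).
Hypothesis chi_surj : forall y, exists x, chi x = y.
Variables (B : pzRingType) (kap : K -> B).
Variables (n : nat) (sig : B -> 'M[F]_n).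
Hypotheses (sigh : mx_hom chi kap sig) (signd : mx_nondegenerate sig).

Let sigD : {morph sig : x y / x + y}. Proof. by case: sigh. Qed.
Let sigM : {morph sig : x y / x * y >-> x *m y}. Proof. by case: sigh. Qed.
Let sig1 : sig 1 = 1%:M. Proof. by case: sigh. Qed.
Let sigK c : sig (kap c) = (chi c)%:M. Proof. by case: sigh. Qed.
Let sig0 : sig 0 = 0. Proof. exact: mx_hom0 sigh. Qed.
Let sigN : {morph sig : x / - x}.
Proof. by move=> x; apply/eqP; rewrite -addr_eq0 -sigD addNr sig0. Qed.
Let sigB : {morph sig : x y / x - y}.
Proof. by move=> x y; rewrite sigD sigN. Qed.

(* McCoy: [z] is regular as soon as some [z - z q z], which can be chosen of
   smaller rank, is. *)
Lemma mx_nondegenerate_regular z :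
  exists q, sig z = sig z *m sig q *m sig z.
Proof.
have [r] := ubnP (\rank (sig z)); elim: r z => // r IH z zr.
have [z0|z0] := eqVneq (sig z) 0; first by exists 0; rewrite sig0 mulmx0 mul0mx.
have [q [v [v0 vE]]] := signd z0.
pose z' := z - z * q * z.
have z'E : sig z' = sig z *m (1%:M - sig q *m sig z).
  by rewrite sigB !sigM mulmxBr mulmx1 mulmxA.
have z'E2 : sig z' = (1%:M - sig z *m sig q) *m sig z.
  by rewrite sigB !sigM mulmxBl mul1mx.
have lt : (\rank (sig z') < \rank (sig z))%N.
  (* Since [v] is fixed by [sig z *m sig q], the product [v *m sig z'] vanishes, while [v *m sig z]
     does not. *)
  apply: (mxrank_lt_mulmxr z'E) => -[d' zd].
  move/eqP: v0; apply; rewrite -vE zd z'E2 !mulmxA mulmxBr mulmx1 !mulmxA vE.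
  by rewrite subrr !mul0mx.
have [q' q'E] := IH z' (leq_trans lt zr).
(* As z' = (1 - z q) z = z (1 - q z), the relation z' = z' q' z' reads z - z q z = z (1 - q z) q' (1
   - z q) z under [sig]. *)
exists (q + (1 - q * z) * q' * (1 - z * q)).
have zE : sig z = sig z' + sig z *m sig q *m sig z.
  by rewrite sigB !sigM subrK.
rewrite {1}zE q'E {1}z'E z'E2 sigD !sigM !sigB !sigM sig1.
by rewrite [sig z *m (sig q + _)]mulmxDr [in RHS]mulmxDl addrC !mulmxA.
Qed.

(** Fitting's argument: the row spaces of the powers of [sig z] decrease, so two consecutive ones
    agree, and then so do the right kernels. *)
Lemma mx_power_stable z : exists l, forall y : 'M_n,
  sig (z ^+ l.+1) *m y = 0 -> sig (z ^+ l) *m y = 0.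
Proof.
have sl l : (sig (z ^+ l.+1) <= sig (z ^+ l))%MS.
  by rewrite exprS sigM submxMl.
have [l /submxP[D lE]] : exists l, (sig (z ^+ l) <= sig (z ^+ l.+1))%MS.
  apply: contrapT => /forallNP nl.
  have : forall l, (l + \rank (sig (z ^+ l)) <= n)%N.
    elim=> [|l IH]; first exact: rank_leq_row.
    rewrite addSnnS; apply: leq_trans IH; rewrite leq_add2l.
    by apply: rank_ltmx; rewrite ltmxE sl; apply/negP/nl.
  by move=> /(_ n.+1); rewrite leqNgt ltn_addr.
by exists l => y y0; rewrite lE -mulmxA y0 mulmx0.
Qed.

(* Take [a] such that [z = x + y a] has maximal rank, and [z = z q z]. If
   [z] is singular, then [b = (1 - z q) c (1 - q z)] is nonzero for some [c],
   and a suitable perturbation of [a] by [b] increases the rank. *)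
Lemma mx_stable_range1 x p y c0 : c0 != 0 -> sig (x * p + y) = c0%:M ->
  exists a, sig (x + y * a) \in unitmx.
Proof.
move=> c00 pE; have [k0 k0E] := chi_surj c0^-1.
pose P r := `[< exists a, \rank (sig (x + y * a)) = r >].
have exP : exists r, P r.
  by exists (\rank (sig (x + y * 0))); apply/asboolP; exists 0.
have boundP r : P r -> (r <= n)%N.
  by move=> /asboolP[a <-]; exact: rank_leq_row.
case: (ex_maxnP exP boundP) => r /asboolP[a ar] rmax; exists a.
rewrite -row_full_unit /row_full; apply: contraT => zn.
set z := x + y * a in ar zn.
(* Substituting x = z - y a into x p + y and dividing by the scalar [c0] gives z p' + y Q, which
   [sig] maps to 1. *)
pose p' := p * kap k0; pose Q := (1 - a * p) * kap k0.
have yQ : sig y *m sig Q = 1%:M - sig z *m sig p'.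
  have : sig (z * p' + y * Q) = 1%:M.
    have -> : z * p' + y * Q = (x * p + y) * kap k0.
      rewrite /z /p' /Q !mulrA -mulrDl; congr (_ * _).
      by rewrite mulrBr mulr1 mulrDl mulrA addrA addrAC addrK.
    by rewrite sigM pE sigK k0E -scalar_mxM mulfV.
  by rewrite sigD !sigM => <-; rewrite addrAC subrr add0r.
have [q qE] := mx_nondegenerate_regular z.
pose e := sig q *m sig z; pose g := sig z *m sig q.
have ze : sig z *m e = sig z by rewrite mulmxA -qE.
have gz : g *m sig z = sig z by rewrite -qE.
have ee : e *m e = e by rewrite /e -mulmxA [sig z *m _]mulmxA -qE.
have gg : g *m g = g by rewrite /g mulmxA -qE.
have [[c cn0]|/forallNP call] :=
    pselect (exists c, (1%:M - g) *m sig c *m (1%:M - e) != 0).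
  (* [M] has larger rank than [sig z]: right multiplication by [e] turns [M] into [sig z], while
     left multiplication by 1 - g kills [sig z] but turns [M] into [sig b], which is nonzero. *)
  pose b := (1 - z * q) * c * (1 - q * z).
  have bE : sig b = (1%:M - g) *m sig c *m (1%:M - e).
    by rewrite !sigM !sigB !sigM sig1.
  pose M := sig (x + y * (a + Q * b)).
  have ME : M = sig z + sig y *m sig Q *m sig b.
    by rewrite /M mulrDr addrA sigD mulrA !sigM.
  have Me : M *m e = sig z.
    have be : sig b *m e = 0
      by rewrite bE -(mulmxA _ _ e) [_ *m e]mulmxBl mul1mx ee subrr mulmx0.
    by rewrite ME mulmxDl ze -mulmxA be mulmx0 addr0.
  have gM : (1%:M - g) *m M = sig b.
    have gz0 : (1%:M - g) *m sig z = 0 by rewrite mulmxBl mul1mx gz subrr.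
    rewrite ME mulmxDr gz0 add0r yQ mulmxA mulmxBr mulmx1 mulmxA gz0 mul0mx.
    have gg1 : (1%:M - g) *m (1%:M - g) = 1%:M - g.
      by rewrite mulmxBr mulmx1 mulmxBl mul1mx gg subrr subr0.
    by rewrite subr0 bE 2!mulmxA gg1.
  have lt : (\rank (sig z) < \rank M)%N.
    apply: (mxrank_lt_mulmxr (esym Me)) => -[d Md].
    move/eqP: cn0; apply; rewrite -bE -gM Md mulmxBl mul1mx !mulmxA gz.
    exact: subrr.
  have : P (\rank M) by apply/asboolP; exists (a + Q * b).
  by move=> /rmax; rewrite -ar leqNgt lt.
(* Now 1 - g kills every [sig c *m X], so for every l there is c with X = z^l c X under [sig]. As
   [sig z *m X = 0], stability of the kernels of powers forces [X = 0]; then [e] is the identity and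
   [sig z] has full rank. *)
pose X := 1%:M - e.
have cX c : sig c *m X = sig z *m sig q *m sig c *m X.
  have /negP := call c; rewrite negbK => /eqP.
  by rewrite mulmxBl mul1mx mulmxBl => /eqP; rewrite subr_eq0 => /eqP.
have zX : sig z *m X = 0 by rewrite mulmxBr mulmx1 ze subrr.
have XE l : exists c, X = sig (z ^+ l) *m sig c *m X.
  elim: l => [|l [c cE]]; first by exists 1; rewrite expr0 sig1 !mul1mx.
  by exists (q * c); rewrite {1}cE -mulmxA cX exprSr !sigM !mulmxA.
have [l lP] := mx_power_stable z.
have [c cE] := XE l.
have X0 : X = 0.
  rewrite cE -mulmxA; apply: lP.
  by rewrite exprS sigM -mulmxA [sig (z ^+ l) *m _]mulmxA -cE.
move: zn; rewrite eqn_leq rank_leq_row /= => /negP; case.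
have en : \rank e = n.
  by move/eqP: X0; rewrite subr_eq0 => /eqP <-; rewrite mxrank1.
by rewrite -[leqLHS]en mxrankM_maxr.
Qed.

End StableRange.

(** * Elements invertible at a maximal ideal *)

Lemma Cayley_Hamilton_nz (R : comNzRingType) n (T : 'M[R]_n.+1) :
  exists (d : nat) (a : nat -> R),
    \sum_(i < d.+1) a i *: T ^+ i = 0 /\ a 0%N = (-1) ^+ n.+1 * \det T.
Proof.
exists (size (char_poly T)).-1, (nth 0 (char_poly T)); split; last first.
  exact: char_poly_det.
rewrite prednK; last by rewrite size_char_poly.
rewrite -[RHS](Cayley_Hamilton T) -[in RHS](coefK (char_poly T)) poly_def.
rewrite linear_sum; apply: eq_bigr => i _.
by rewrite linearZ /= rmorphXn /= horner_mx_X.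
Qed.

Lemma Cayley_Hamilton_pz (R : comPzRingType) n (T : 'M[R]_n.+1) : 1 != 0 :> R ->
  exists (d : nat) (a : nat -> R),
    \sum_(i < d.+1) a i *: T ^+ i = 0 /\ a 0%N = (-1) ^+ n.+1 * \det T.
Proof.
move=> R1.
pose R' : comNzRingType := HB.pack R (GRing.PzSemiRing_isNonZero.Build R R1).
exact: (@Cayley_Hamilton_nz R' n T).
Qed.

Section UnitAt.
Variables (R : comPzRingType) (B : pzRingType) (phi : algStr R B).

(** For a maximal ideal [m]: invertibility of [u] in the localization of [B] at [m], with
    denominators cleared. *)
Definition unit_at (m : set R) (u : B) : Prop :=
  exists q r, [/\ ~ m r, q * u = phi r & u * q = phi r].

Variable V : lmodType B.
Hypothesis Vfg : exists n (e : 'I_n -> V), forall v, exists c : 'I_n -> R,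
  v = \sum_i phi (c i) *: e i.
Hypothesis Vfaithful : forall b : B, (forall v : V, b *: v = 0) -> b = 0.
Variable m : set R.
Hypothesis maxm : is_maximal_ideal m.

Let m0 : m 0. Proof. by case: maxm => -[]. Qed.
Let mD x y : m x -> m y -> m (x + y). Proof. by case: maxm => -[_ + _] _ _; apply. Qed.
Let mM a x : m x -> m (a * x). Proof. by case: maxm => -[_ _ +] _ _; apply. Qed.
Let mN1 : ~ m 1. Proof. by case: maxm. Qed.
Let mprime x y : m (x * y) -> m x \/ m y.
Proof. by case: (maximal_ideal_prime maxm) => _ _; apply. Qed.

Let R1 : 1 != 0 :> R. Proof. by apply/eqP => e; apply: mN1; rewrite e. Qed.

Let comb n (e : 'I_n -> V) (x : 'rV[R]_n) : V := \sum_i phi (x 0 i) *: e i.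

(* Minimality of [n] forces the coefficients of any relation into [m]. *)
Lemma local_minimal_generators : exists n (e : 'I_n -> V) s,
  [/\ ~ m s, forall v, exists x, phi s *: v = comb e x &
      forall x, comb e x = 0 -> forall i, m (x 0 i)].
Proof.
pose P n := `[< exists (e : 'I_n -> V) s,
  ~ m s /\ forall v, exists x, phi s *: v = comb e x >].
have exP : exists n, P n.
  have [n [e eP]] := Vfg; exists n; apply/asboolP; exists e, 1; split=> // v.
  have [c ->] := eP v; exists (\row_i c i).
  by rewrite rmorph1 scale1r; apply: eq_bigr => i _; rewrite mxE.
case: (ex_minnP exP) => n /asboolP[e [s [ms eP]]] nmin.
exists n, e, s; split=> // x x0 i; apply: contrapT => mxi.
case: n => [|n] in e eP nmin x x0 i mxi *; first by case: i {mxi}.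
suff /nmin : P n by rewrite ltnn.
apply/asboolP; exists (e \o lift i), (x 0 i * s).
split=> [/mprime[]//|v]; have [y yE] := eP v.
(* Multiply [phi s *: v = comb e y] by [x 0 i], then eliminate [e i] by means of the relation
   [x]. *)
exists (\row_l (x 0 i * y 0 (lift i l) - y 0 i * x 0 (lift i l))).
rewrite rmorphM -scalerA yE /comb scaler_sumr (bigD1_ord i)//=.
have xiE : phi (x 0 i) *: e i = - \sum_l phi (x 0 (lift i l)) *: e (lift i l).
  by apply/eqP; rewrite -addr_eq0; apply/eqP; rewrite -[RHS]x0 /comb (bigD1_ord i).
rewrite scalerA alg_central -scalerA xiE scalerN scaler_sumr addrC -sumrB.
by apply: eq_bigr => l _; rewrite mxE rmorphB !rmorphM scalerBl !scalerA.
Qed.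

Section ResidueRepresentation.
Variables (F : fieldType) (pi : {rmorphism R -> F}).
Hypothesis pi_ker : forall x, pi x = 0 <-> m x.
Variables (n : nat) (e : 'I_n -> V) (s : R).
Hypothesis ms : ~ m s.
Hypothesis egen : forall v, exists x, phi s *: v = comb e x.
Hypothesis eindep : forall x, comb e x = 0 -> forall i, m (x 0 i).

Let combD x y : comb e (x + y) = comb e x + comb e y.
Proof.
rewrite /comb -big_split; apply: eq_bigr => i _ /=.
by rewrite mxE rmorphD scalerDl.
Qed.
Let combZ a x : comb e (a *: x) = phi a *: comb e x.
Proof.
rewrite /comb scaler_sumr; apply: eq_bigr => i _ /=.
by rewrite mxE rmorphM scalerA.
Qed.
Let combN x : comb e (- x) = - comb e x.
Proof. by rewrite -(scaleN1r x) combZ rmorphN1 scaleN1r. Qed.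
Let comb_sum (I : finType) (f : I -> 'rV_n) :
  comb e (\sum_i f i) = \sum_i comb e (f i).
Proof.
elim/big_rec2: _ => [|i x y _ <-]; last exact: combD.
by rewrite /comb big1 // => i _; rewrite mxE rmorph0 scale0r.
Qed.

Fact action_mx_ex (u : B) : exists T : 'M[R]_n,
  forall i, phi s *: (u *: e i) = comb e (row i T).
Proof.
have [f fE] := choice (fun i => egen (u *: e i)).
by exists (\matrix_i f i) => i; rewrite rowK.
Qed.

Definition action_mx (u : B) : 'M[R]_n := projT1 (cid (action_mx_ex u)).

Lemma action_mxE u x :
  phi s *: (u *: comb e x) = comb e (x *m action_mx u).
Proof.
rewrite mulmx_sum_row comb_sum {1}/comb !scaler_sumr; apply: eq_bigr => i _.
rewrite combZ /action_mx; case: cid => T /= <-.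
by rewrite [u *: _]scalerA -alg_central !scalerA !mulrA [phi s * _]alg_central.
Qed.

Lemma comb_inj_mod x y : comb e x = comb e y -> map_mx pi x = map_mx pi y.
Proof.
move=> xy; apply/rowP => i; rewrite !mxE; apply/eqP; rewrite -subr_eq0 -rmorphB.
apply/eqP/pi_ker.
have -> : x 0 i - y 0 i = (x - y) 0 i by rewrite !mxE.
by apply: eindep; rewrite combD combN xy subrr.
Qed.

Let pis0 : pi s != 0. Proof. by apply/eqP => /pi_ker. Qed.

(** Division by [pi s] makes up for the factor [s] in [action_mx]; the converse ring appears because
    matrices act on rows from the right. *)
Definition residue_mx (u : B^c) : 'M[F]_n :=
  (pi s)^-1 *: map_mx pi (action_mx u).

(** Relations among the [e i] have coefficients in [m], so after reduction the choice of the action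
    matrix does not matter. *)
Lemma residue_mxP (u : B) (A : 'M[R]_n) a :
  (forall x, phi a *: (u *: comb e x) = comb e (x *m A)) ->
  pi a *: residue_mx u = map_mx pi A.
Proof.
move=> AE; apply/row_matrixP => i; rewrite /residue_mx.
suff : pi a *: map_mx pi (row i (action_mx u)) = pi s *: map_mx pi (row i A).
  rewrite !map_row => h; rewrite scalerA mulrC -scalerA linearZ /= linearZ /= h.
  by rewrite scalerA mulVf// scale1r.
rewrite -!map_mxZ; apply: comb_inj_mod; rewrite !combZ !rowE -action_mxE -AE.
by rewrite !scalerA -!(rmorphM (alg_map phi)) [a * s]mulrC.
Qed.

Lemma residue_mx_alg r : residue_mx (phi r) = (pi r)%:M.
Proof.
have := @residue_mxP (phi r) (r%:M) 1; rewrite (rmorph1 pi) scale1r map_scalar_mx.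
by apply => x; rewrite rmorph1 mul_mx_scalar combZ scale1r.
Qed.

Lemma residue_mx_hom : mx_hom pi (phi : R -> B^c) residue_mx.
Proof.
split.
- move=> u v.
  have := @residue_mxP (u + v) (action_mx u + action_mx v) s.
  rewrite map_mxD => h; apply: (can_inj (scalerK pis0)); rewrite h.
    by rewrite scalerDr !scalerA mulfV// !scale1r.
  by move=> x; rewrite mulmxDr combD scalerDl scalerDr !action_mxE.
- move=> u v.
  have := @residue_mxP ((v : B) * u) (action_mx u *m action_mx v) (s * s).
  rewrite map_mxM => h.
  apply: (can_inj (scalerK pis0)); apply: (can_inj (scalerK pis0)).
  rewrite [LHS]scalerA -rmorphM [LHS]h => [|x].
    by rewrite /residue_mx -scalemxAl -scalemxAr !scalerA mulfK// mulfV// scale1r.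
  rewrite mulmxA -action_mxE -(action_mxE u).
  rewrite !scalerA !rmorphM -!mulrA; congr (_ *: _); congr (_ * _).
  by rewrite !mulrA alg_central.
- by have := residue_mx_alg 1; rewrite !rmorph1.
- exact: residue_mx_alg.
Qed.

(** The determinant trick: the matrix of y = s u has determinant outside [m], so Cayley-Hamilton
    gives a polynomial in y with constant term [a 0] outside [m] that kills s V. By faithfulness s
    (a 0 + w y) = 0, which inverts [u] up to a scalar outside [m]. *)
Lemma residue_mx_unit (u : B) : residue_mx u \in unitmx -> unit_at m u.
Proof.
move=> uu; set T := action_mx u.
pose y := phi s * u.
have yE k x : y ^+ k *: comb e x = comb e (iter k (mulmx^~ T) x).
  elim: k => [|k IH]; first by rewrite expr0 scale1r.
  by rewrite exprS -scalerA IH /y -scalerA action_mxE.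
have [d [a [aT a0]]] : exists (d : nat) (a : nat -> R),
    (forall x : 'rV[R]_n, \sum_(i < d.+1) a i *: iter i (mulmx^~ T) x = 0) /\ ~ m (a 0%N).
  have detT : ~ m (\det T).
    move=> /pi_ker; rewrite -det_map_mx => dT.
    move: uu; rewrite unitmxE /residue_mx detZ -/T dT mulr0.
    by rewrite unitr0.
  (* Without generators all rows are equal to 0, and the constant polynomial 1 serves. *)
  clear -detT R1 mN1 mM; move: T detT; case: n => [|k] T detT.
    exists 0%N, (fun _ => 1); split=> // x; apply/rowP => -[//].
  have [d [a [aT a0]]] := Cayley_Hamilton_pz T R1.
  exists d, a; split=> [x|].
    transitivity (x *m \sum_(i < d.+1) a i *: T ^+ i); last by rewrite aT mulmx0.
    rewrite mulmx_sumr; apply: eq_bigr => i _.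
    rewrite -scalemxAr; congr (_ *: _).
    elim: (i : nat) => [|j IH]; first by rewrite expr0 mulmx1.
    by rewrite exprSr mulmxA -IH.
  by rewrite a0 => /(mM ((-1) ^+ k.+1)); rewrite signrMK.
pose w := \sum_(i < d) phi (a i.+1) * y ^+ i.
have uy : GRing.comm u y by rewrite /GRing.comm /y -[RHS]mulrA mulrA -alg_central mulrA.
have uw : u * w = w * u.
  rewrite mulr_sumr mulr_suml; apply: eq_bigr => i _.
  by rewrite mulrA -alg_central -!mulrA (commrX i uy).
have PE : \sum_(i < d.+1) phi (a i) * y ^+ i = phi (a 0%N) + w * y.
  rewrite big_ord_recl expr0 mulr1 mulr_suml; congr (_ + _).
  by apply: eq_bigr => i _; rewrite /= exprSr mulrA.
have P0 : phi s * (phi (a 0%N) + w * y) = 0.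
  apply: Vfaithful => v; have [x xE] := egen v.
  rewrite alg_central -scalerA xE -PE scaler_suml.
  transitivity (comb e 0); last by rewrite -(scale0r 0) combZ rmorph0 scale0r.
  rewrite -(aT x) comb_sum; apply: eq_bigr => i _.
  by rewrite -scalerA yE combZ.
have swu : phi s * phi s * w * u = u * (phi s * phi s * w).
  by rewrite -rmorphM -[LHS]mulrA -uw mulrA alg_central mulrA.
have sE : phi (s * a 0%N) = - (phi s * phi s * w * u).
  apply/eqP; rewrite rmorphM -addr_eq0 -[X in _ == X]P0 mulrDr /y.
  by rewrite [w * (phi s * u)]mulrA -(alg_central phi s w) !mulrA.
exists (- (phi s * phi s * w)), (s * a 0%N); split.
- by move=> /mprime[].
- by rewrite mulNr sE.
- by rewrite mulrN -swu sE.
Qed.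

End ResidueRepresentation.
Lemma residue_representation : exists (F : fieldType) (pi : {rmorphism R -> F})
    n (rho : B^c -> 'M[F]_n),
  [/\ forall y, exists x, pi x = y, forall x, pi x = 0 <-> m x,
      mx_hom pi (phi : R -> B^c) rho &
      forall u, rho u \in unitmx -> unit_at m u].
Proof.
have [F [pi [pis pik]]] := residue_field_ex maxm.
have [n [e [s [ms egen eind]]]] := local_minimal_generators.
exists F, pi, n, (residue_mx pi egen); split=> //.
  exact: residue_mx_hom.
exact: residue_mx_unit.
Qed.

(** Over the residue field a one-sided inverse of a square matrix is two-sided, and the residue
    representation detects units at [m]. *)
Lemma unit_at_left q u r : ~ m r -> q * u = phi r -> unit_at m u.
Proof.
move=> mr qu; have [F [pi [n [rho [_ pik [_ rhoM _ rhoK] rhou]]]]] :=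
  residue_representation.
apply: rhou.
have : rho u *m rho q = (pi r)%:M by rewrite -rhoK -qu -rhoM.
have pr0 : pi r != 0 by apply/eqP => /pik.
move=> /(congr1 (fun x => x *m (pi r)^-1%:M)).
by rewrite -mulmxA -scalar_mxM mulfV// => /mulmx1_unit[].
Qed.

(** Modulo [m] the sum disappears, and [u] acts as the nonzero scalar [pi r]. *)
Lemma unit_at_perturb u r (I : finType) (mu : I -> R) (b : I -> B) :
  ~ m r -> (forall i, m (mu i)) -> u = phi r + \sum_i phi (mu i) * b i ->
  unit_at m u.
Proof.
move=> mr mmu uE; have [F [pi [n [rho [_ pik rhoh rhou]]]]] :=
  residue_representation.
case: (rhoh) => rhoD rhoM _ rhoK; apply: rhou.
have pr0 : pi r != 0 by apply/eqP => /pik.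
have -> : rho u = (pi r)%:M.
  rewrite uE rhoD rhoK -[RHS]addr0; congr (_ + _).
  elim/big_rec: _ => [|i x _ x0]; first exact: mx_hom0 rhoh.
  rewrite rhoD x0 addr0.
  have -> : phi (mu i) * b i = (b i : B^c) * phi (mu i) by [].
  by rewrite rhoM rhoK (pik _).2// raddf0 mulmx0.
by rewrite unitmxE det_scalar unitfE expf_neq0.
Qed.

(* [B] localized at [m] is semilocal, hence has stable range 1. *)
Lemma unit_at_stable_range1 p x y r : ~ m r -> p * x + y = phi r ->
  exists a, unit_at m (x + a * y).
Proof.
move=> mr pxy; have [F [pi [n [rho [pis pik rhoh rhou]]]]] :=
  residue_representation.
have pr0 : pi r != 0 by apply/eqP => /pik.
have [n' [sig [sigh signd sigu]]] := mx_hom_semisimplify pis rhoh.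
(* In the converse ring [p * x + y] reads [x * p + y]. *)
have [||a au] := @mx_stable_range1 _ _ _ pis _ _ _ _ sigh signd x p y (pi r).
- by [].
- by case: sigh => _ _ _ <-; congr (sig _).
- by exists a; apply: rhou; apply: sigu.
Qed.

End UnitAt.

(** * Matrices over an algebra, and their ranks at a maximal ideal *)

Section CentralScalars.
Variables (R : comPzRingType) (E : pzRingType) (iota : algStr R E).

Definition cmx n (r : R) : 'M[E]_n := (iota r)%:M.

Lemma mul_cmx m n r (A : 'M[E]_(m, n)) : cmx m r *m A = A *m cmx n r.
Proof.
apply/matrixP => i j; rewrite /cmx mul_scalar_mx !mxE (bigD1 j)//= big1 ?addr0.
  by rewrite mxE eqxx mulr1n alg_central.
by move=> l /negPf lj; rewrite !mxE lj mulr0n mulr0.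
Qed.

Fact cmx_zmod n : zmod_morphism (@cmx n).
Proof. by move=> x y; rewrite /cmx rmorphB raddfB. Qed.
Fact cmx_monoid n : monoid_morphism (@cmx n).
Proof.
by split=> [|x y]; rewrite /cmx ?rmorph1 ?rmorphM ?scalar_mxM.
Qed.
HB.instance Definition _ n := GRing.isZmodMorphism.Build R 'M[E]_n (@cmx n) (@cmx_zmod n).
HB.instance Definition _ n := GRing.isMonoidMorphism.Build R 'M[E]_n (@cmx n) (@cmx_monoid n).

Definition cmx_alg n : algStr R 'M[E]_n :=
  @AlgStr R 'M[E]_n (@cmx n) (fun r A => mul_cmx r A).

Variable N : lmodType E.

(** Column vectors over [N], a module over square matrices. It is again faithful and finitely
    generated over [R], so the results on [unit_at] apply to matrix rings over [E]. *)
Definition colmod (n : nat) : Type := {ffun 'I_n -> N}.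
HB.instance Definition _ n := GRing.Zmodule.on (colmod n).

Definition col_scale n (A : 'M[E]_n) (v : colmod n) : colmod n :=
  [ffun i => \sum_j A i j *: v j].

Fact col_scaleA n (A A' : 'M[E]_n) v :
  col_scale A (col_scale A' v) = col_scale (A * A') v.
Proof.
apply/ffunP => i; rewrite !ffunE.
transitivity (\sum_j \sum_k (A i j * A' j k) *: v k).
  apply: eq_bigr => j _; rewrite ffunE scaler_sumr.
  by apply: eq_bigr => k _; rewrite scalerA.
by rewrite exchange_big; apply: eq_bigr => k _; rewrite mxE scaler_suml.
Qed.
Fact col_scale1 n : left_id 1 (@col_scale n).
Proof.
move=> v; apply/ffunP => i; rewrite ffunE (bigD1 i)//= big1 ?addr0.
  by rewrite mxE eqxx scale1r.
by move=> j /negPf ji; rewrite mxE eq_sym ji scale0r.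
Qed.
Fact col_scaleDr n : right_distributive (@col_scale n) +%R.
Proof.
move=> A v w; apply/ffunP => i; rewrite !ffunE -big_split.
by apply: eq_bigr => j _; rewrite ffunE scalerDr.
Qed.
Fact col_scaleDl n v : {morph (@col_scale n)^~ v : A A' / A + A'}.
Proof.
move=> A A'; apply/ffunP => i; rewrite !ffunE -big_split.
by apply: eq_bigr => j _; rewrite mxE scalerDl.
Qed.
HB.instance Definition _ n := GRing.Zmodule_isLmodule.Build 'M[E]_n (colmod n)
  (@col_scaleA n) (@col_scale1 n) (@col_scaleDr n) (@col_scaleDl n).

Hypothesis Nfg : exists n (e : 'I_n -> N), forall v, exists c : 'I_n -> R,
  v = \sum_i iota (c i) *: e i.
Hypothesis Nfaithful : forall b : E, (forall v : N, b *: v = 0) -> b = 0.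

Lemma colmod_fg k : exists n (e : 'I_n -> colmod k), forall v,
  exists c : 'I_n -> R, v = \sum_i cmx_alg k (c i) *: e i.
Proof.
have [n [e eP]] := Nfg.
pose f (x : 'I_k * 'I_n) : colmod k := [ffun i => if i == x.1 then e x.2 else 0].
exists #|{: 'I_k * 'I_n}|, (fun i => f (enum_val i)) => v.
have [c cP] := choice (fun i => eP (v i)).
exists (fun i => c (enum_val i).1 (enum_val i).2).
rewrite -(reindex (@enum_val _ {: 'I_k * 'I_n}) (P := xpredT)
  (F := fun x : 'I_k * 'I_n => cmx_alg k (c x.1 x.2) *: f x))/=; last first.
  exact/onW_bij/enum_val_bij.
rewrite -(pair_bigA _ (fun i j => cmx_alg k (c i j) *: f (i, j)))/=.
apply/ffunP => i; rewrite cP sum_ffunE (bigD1 i)//= [X in _ + X]big1 ?addr0.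
  rewrite sum_ffunE; apply: eq_bigr => j _.
  rewrite ffunE (bigD1 i)//= big1 ?addr0 => [|l /negPf li].
    by rewrite ffunE /= eqxx mxE eqxx mulr1n.
  by rewrite mxE eq_sym li mulr0n scale0r.
move=> l /negPf li; rewrite sum_ffunE big1// => j _.
rewrite ffunE (bigD1 i)//= big1 ?addr0 => [|l' /negPf li'].
  by rewrite ffunE /= eq_sym li scaler0.
by rewrite mxE eq_sym li' mulr0n scale0r.
Qed.

Lemma colmod_faithful k (b : 'M[E]_k) : (forall v : colmod k, b *: v = 0) -> b = 0.
Proof.
move=> b0; apply/matrixP => i j; rewrite mxE; apply: Nfaithful => v.
have /ffunP/(_ i) := b0 [ffun l => if l == j then v else 0].
rewrite !ffunE (bigD1 j)//= big1 ?addr0 ?ffunE ?eqxx// => l /negPf lj.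
by rewrite ffunE lj scaler0.
Qed.

Variable m : set R.
Hypothesis maxm : is_maximal_ideal m.

Definition mx_unit_at k (u : 'M[E]_k) := unit_at (cmx_alg k) m u.

Let mprime x y : m (x * y) -> m x \/ m y.
Proof. by case: (maximal_ideal_prime maxm) => _ _; apply. Qed.

(* [mx_rank_at X j]: at [m], the map with matrix [X] has a split surjection
   onto [j] copies of [N] as a compression. *)
Definition mx_rank_at p q (X : 'M[E]_(p, q)) (j : nat) : Prop :=
  exists (C : 'M_(j, p)) (D : 'M_(q, j)) r, ~ m r /\ C *m X *m D = cmx j r.

Lemma mx_rank_at_unit p q (X : 'M[E]_(p, q)) j (C : 'M_(j, p)) (D : 'M_(q, j)) :
  mx_unit_at (C *m X *m D) -> mx_rank_at X j.
Proof.
move=> [w [r [mr wu _]]]; exists (w *m C), D, r; split=> //.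
transitivity (w *m (C *m X *m D)); last exact: wu.
by rewrite !mulmxA.
Qed.

Lemma mx_rank_at_le p q (X : 'M[E]_(p, q)) i j :
  (i <= j)%N -> mx_rank_at X j -> mx_rank_at X i.
Proof.
move=> ij [C [D [r [mr CD]]]].
exists (pid_mx i *m C), (D *m pid_mx i), r; split=> //.
transitivity ((pid_mx i : 'M[E]_(i, j)) *m (C *m X *m D) *m (pid_mx i : 'M[E]_(j, i))).
  by rewrite !mulmxA.
rewrite CD -mul_cmx -mulmxA mul_pid_mx minnn (minn_idPr ij) pid_mx_1.
exact: mulmx1.
Qed.

(* Evans' cancellation: a row [v] is cancelled against a column [c] by means of
   stable range 1 for [v1 c1 + (r - v1 c1) = r], where [v1] and [c1] are their
   first entries. *)
Lemma mx_rank_at_drop p q (X : 'M[E]_(p, q)) (x : 'rV_q) (a : 'cV_p) j :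
  mx_rank_at (col_mx X x) j.+1 -> mx_rank_at (X + a *m x) j.
Proof.
move=> [C [D [r [mr CDr]]]].
pose C0 : 'M[E]_(1 + j, p) := lsubmx C.
pose c : 'M[E]_(1 + j, 1) := rsubmx C - C0 *m a.
pose v : 'M[E]_(1, 1 + j) := x *m D.
(* Up to the rank one term [c *m v], the compression of [X + a *m x] is scalar; it remains to
   compress this difference to a scalar matrix of size [j]. *)
have CE : C0 *m (X + a *m x) *m D = cmx (1 + j) r - c *m v.
  apply/eqP; rewrite eq_sym subr_eq -CDr.
  rewrite -[C in C *m _ *m _](hsubmxK (C : 'M_(1 + j, p + 1))) mul_row_col.
  rewrite /c /v mulmxDr mulmxBl !mulmxDl -!mulmxA.
  by rewrite [X in _ == X]addrACA subrr addr0.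
clearbody c v.
pose c1 : 'M[E]_1 := usubmx c; pose c2 : 'M_(j, 1) := dsubmx c.
pose v1 : 'M[E]_1 := lsubmx v; pose v2 : 'M_(1, j) := rsubmx v.
have [||a' [w [s [ms wu uw]]]] := @unit_at_stable_range1 _ _ (cmx_alg 1) _
   (colmod_fg 1) (@colmod_faithful 1) _ maxm v1 c1 (cmx 1 r - v1 *m c1) r.
- by [].
- by rewrite addrC subrK.
(* [Z] and [D'] are chosen so that Z c = c2 w a' r; then Z c v D' cancels all of r Z D' except the
   scalar r s. *)
pose Z : 'M[E]_(j, 1 + j) := row_mx (- (c2 *m w *m (1%:M - a' *m v1))) (cmx j s).
pose D' : 'M[E]_(1 + j, j) := col_mx (- (a' *m v2)) 1%:M.
exists (Z *m C0), (D *m D'), (r * s); split; first by move=> /mprime[].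
transitivity (Z *m (C0 *m (X + a *m x) *m D) *m D'); first by rewrite !mulmxA.
rewrite CE mulmxBr mulmxBl -[Z *m _]mul_cmx -!mulmxA [Z *m (c *m _)]mulmxA.
have sw : cmx j s *m c2 = c2 *m w *m (c1 + a' *m (cmx 1 r - v1 *m c1)).
  by rewrite mul_cmx -mulmxA; congr (_ *m _); exact: (esym wu).
have -> : Z *m c = c2 *m w *m a' *m cmx 1 r.
  have -> : Z *m c = - (c2 *m w *m (1%:M - a' *m v1)) *m c1 + cmx j s *m c2.
    by rewrite -[c in LHS]vsubmxK mul_row_col.
  rewrite sw; set P := c2 *m w; clearbody P.
  rewrite mulNmx [P *m (_ - _)]mulmxBr mulmx1 mulmxBl opprB mulmxDr.
  rewrite [a' *m (_ - _)]mulmxBr [P *m (_ - _)]mulmxBr !mulmxA.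
  by rewrite addrA subrK addrC subrK.
have -> : v *m D' = v2 - v1 *m a' *m v2.
  by rewrite -(hsubmxK v) mul_row_col mulmx1 mulmxN addrC mulmxA.
have -> : Z *m D' = c2 *m w *m (a' - a' *m v1 *m a') *m v2 + cmx j s.
  rewrite mul_row_col mulmx1 mulmxN mulNmx opprK; congr (_ + _).
  rewrite -!mulmxA [(1%:M - _) *m _]mulmxBl mul1mx [(a' - _) *m v2]mulmxBl.
  by rewrite !mulmxA.
have -> : c2 *m w *m (a' - a' *m v1 *m a') *m v2 =
    c2 *m w *m a' *m (v2 - v1 *m a' *m v2).
  rewrite -(mulmxA (c2 *m w) _ v2) -(mulmxA (c2 *m w) a'); congr (_ *m _).
  by rewrite mulmxBl mulmxBr !mulmxA.
rewrite -[_ *m cmx 1 r]mul_cmx -(mulmxA (cmx j r)) mulmxDr addrAC subrr add0r.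
by rewrite [RHS]rmorphM.
Qed.

(** Stable range 1 for matrices of size [j]: from C1 v1 + (C2 v2 + c x D) = r, some v1 + b (C2 v2 +
    c x D) is invertible at [m]. It is a compression of [X] with b c x added to its first [j]
    rows. *)
Lemma mx_rank_at_keep p q (X : 'M[E]_(p, q)) (x : 'rV_q) j : (j <= p)%N ->
  mx_rank_at (col_mx X x) j -> exists a : 'cV_p, mx_rank_at (X + a *m x) j.
Proof.
move=> jp; have [k pE] : exists k, p = (j + k)%N by exists (p - j)%N; rewrite subnKC.
subst p => -[C [D [r [mr CDr]]]].
pose C1 : 'M[E]_j := lsubmx (lsubmx C).
pose C2 : 'M[E]_(j, k) := rsubmx (lsubmx C).
pose c : 'M[E]_(j, 1) := rsubmx C.
pose v1 : 'M[E]_j := usubmx X *m D; pose v2 : 'M[E]_(k, j) := dsubmx X *m D.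
have [||b bu] := @unit_at_stable_range1 _ _ (cmx_alg j) _
   (colmod_fg j) (@colmod_faithful j) _ maxm C1 v1 (C2 *m v2 + c *m (x *m D)) r.
- by [].
- rewrite [RHS]/= -CDr.
  have -> : C = row_mx (row_mx C1 C2) c by rewrite !hsubmxK.
  have -> : X = col_mx (usubmx X) (dsubmx X) by rewrite vsubmxK.
  by rewrite !mul_row_col !mulmxDl -!mulmxA addrA.
have {}bu : mx_unit_at (v1 + b *m (C2 *m v2 + c *m (x *m D))) by exact: bu.
exists (col_mx (b *m c) 0).
apply: (@mx_rank_at_unit _ _ _ _ (row_mx 1%:M (b *m C2)) D).
congr (mx_unit_at _): bu.
rewrite -{1}(vsubmxK X) mul_col_mx mul0mx add_col_mx addr0 mul_row_col mul1mx.
rewrite !mulmxDl !mulmxDr !mulmxA.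
by rewrite addrAC addrA.
Qed.

(** Only the class of [a] modulo [m] matters, so [a] may be prescribed at several maximal ideals at
    once. *)
Lemma mx_rank_at_perturb p q (X : 'M[E]_(p, q)) (x : 'rV_q) (a b : 'cV_p) j
    (I : finType) (mu : I -> R) (z : I -> 'cV_p) :
  (forall i, m (mu i)) -> b = a + \sum_i cmx p (mu i) *m z i ->
  mx_rank_at (X + a *m x) j -> mx_rank_at (X + b *m x) j.
Proof.
move=> mmu bE [C [D [r [mr CD]]]].
apply: (@mx_rank_at_unit _ _ _ _ C D).
apply: (@unit_at_perturb _ _ (cmx_alg j) _ (colmod_fg j) (@colmod_faithful j) _
   maxm _ r I mu (fun i => C *m z i *m x *m D)) => //.
rewrite bE mulmxDl addrA mulmxDr mulmxDl CD; congr (_ + _).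
rewrite !(mulmx_suml, mulmx_sumr); apply: eq_bigr => i _.
transitivity (cmx j (mu i) *m (C *m z i *m x *m D)); last by [].
by rewrite !mulmxA -mul_cmx.
Qed.

(** [C] is a left inverse at [m] of the square matrix [X *m D], hence a two-sided one. *)
Lemma mx_rank_at_square p q (X : 'M[E]_(p, q)) :
  mx_rank_at X p -> exists (D : 'M_(q, p)) r, ~ m r /\ X *m D = cmx p r.
Proof.
move=> [C [D [r [mr CD]]]].
have [w [s [ms wu uw]]] : mx_unit_at (X *m D).
  apply: (@unit_at_left _ _ (cmx_alg p) _ (colmod_fg p) (@colmod_faithful p) _
   maxm C _ _ mr).
  by rewrite -[RHS]/(cmx p r) -CD; exact: mulmxA.
by exists (D *m w), s; rewrite mulmxA.
Qed.

End CentralScalars.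

(** * Noetherian spaces *)

Section NoetherianSpaces.
Variable T : topologicalType.
Hypothesis noethT : noetherian_space T.

Lemma noetherian_ind (P : set T -> Prop) :
  (forall Z, closed Z -> (forall W, closed W -> W `<` Z -> P W) -> P Z) ->
  forall Z, closed Z -> P Z.
Proof.
move=> Pind Z0 cZ0; apply: contrapT => nPZ0.
have /choice[g gP] : forall Z, exists W,
    closed Z /\ ~ P Z -> [/\ closed W, ~ P W & W `<` Z].
  move=> Z; have [[cZ nPZ]|nZ] := pselect (closed Z /\ ~ P Z); last by exists Z.
  have /existsNP[W /not_implyP[cW /not_implyP[WZ nPW]]] :
      ~ forall W, closed W -> W `<` Z -> P W by move/(Pind _ cZ).
  by exists W.
have FP n : closed (iter n g Z0) /\ ~ P (iter n g Z0).
  by elim: n => [//|n /gP[]].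
have [n nP] := noethT (fun n => (FP n).1) (fun n => properW (let: And3 _ _ h := gP _ (FP n) in h)).
have [_ _] := gP _ (FP n).
by rewrite -[g _]/(iter n.+1 g Z0) nP//; case.
Qed.

Lemma irreducible_sub_bigcup (W : set T) (A : set (set T)) :
  irreducible_set W -> finite_set A -> (forall Z, A Z -> closed Z) ->
  W `<=` \bigcup_(Z in A) Z -> exists Z, A Z /\ W `<=` Z.
Proof.
move=> [[x Wx] Wirr] /finite_seqP[s ->] {A}.
elim: s => [|Z s IH] cs Ws.
  by have [Z] := Ws _ Wx.
have cZ : closed Z by apply: cs; rewrite /= inE eqxx.
have cs' Z' : [set` s] Z' -> closed Z'.
  by move=> Zs; apply: cs; rewrite /= inE; apply/orP; right.
have cU : closed (\bigcup_(Z' in [set` s]) Z') by apply: closed_bigcup => //; exact: finite_seq.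
have [|WZ|/(IH cs')[Z' [Z's WZ']]] := Wirr Z _ cZ cU.
- move=> y /Ws[Z' /=]; rewrite inE => /orP[/eqP ->|Z's] Z'y; first by left.
  by right; exists Z'.
- by exists Z; split=> //=; rewrite inE eqxx.
- by exists Z'; split=> //=; rewrite inE; apply/orP; right.
Qed.

Lemma noetherian_irreducible_components (Z : set T) : closed Z ->
  exists A : set (set T), [/\ finite_set A,
    forall W, A W -> closed W /\ irreducible_set W & Z = \bigcup_(W in A) W].
Proof.
move: Z; apply: noetherian_ind => Z cZ IH.
have [->|Z0] := eqVneq Z set0.
  by exists set0; split=> //; rewrite bigcup_set0.
have [Zirr|nZ] := pselect (irreducible_set Z).
  exists [set Z]; split; [exact: finite_set1|by move=> _ ->|].
  by rewrite bigcup_set1.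
have [F [G [cF cG ZFG ZF ZG]]] : exists F G, [/\ closed F, closed G,
    Z `<=` F `|` G, ~ Z `<=` F & ~ Z `<=` G].
  apply: contrapT => nFG; apply: nZ; split; first exact/set0P.
  move=> F G cF cG ZFG; apply: contrapT => /not_orP[ZF ZG].
  by apply: nFG; exists F, G.
have sub F' : closed F' -> ~ Z `<=` F' -> exists A : set (set T),
    [/\ finite_set A, forall W, A W -> closed W /\ irreducible_set W &
        Z `&` F' = \bigcup_(W in A) W].
  move=> cF' ZF'; apply: IH; first exact: closedI.
  by split=> [x []//|ZZF]; apply: ZF' => x /ZZF[].
have [A [Afin AP AE]] := sub F cF ZF; have [A' [A'fin A'P A'E]] := sub G cG ZG.
exists (A `|` A'); split.
- by rewrite finite_setU.
- by move=> W [/AP|/A'P].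
- by rewrite bigcup_setU -AE -A'E -setIUr; apply/esym/setIidl.
Qed.

(* [dimlt Z k] says that [Z] has dimension less than [k]. *)
Definition dimlt (Z : set T) (k : nat) : Prop :=
  ~ exists C, closed_chain k C /\ C k `<=` Z.

Lemma dimlt_sub Z W k : W `<=` Z -> dimlt Z k -> dimlt W k.
Proof. by move=> WZ Zk [C [CC CW]]; apply: Zk; exists C; split=> // x /CW/WZ. Qed.

Lemma dimltS Z k : dimlt Z k -> dimlt Z k.+1.
Proof.
move=> Zk [C [[Ccl Clt] CZ]]; apply: Zk; exists C; split.
  by split=> i ik; [apply: Ccl; exact: leqW|apply: Clt; exact: leqW].
by move=> x Cx; apply: CZ; apply: properW (Clt k _) _ Cx.
Qed.

Lemma dimlt_le Z k l : (k <= l)%N -> dimlt Z k -> dimlt Z l.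
Proof. by move=> /subnKC <-; elim: (l - k)%N => [|i IH]; rewrite ?addn0 ?addnS// => /IH/dimltS. Qed.

Lemma irreducible_closure1 (x : T) : irreducible_set (closure [set x]).
Proof.
split; first by exists x; exact: subset_closure.
move=> F G cF cG FG; have /FG[Fx|Gx] : closure [set x] x by exact: subset_closure.
  by left; rewrite (closure_id F).1//; apply: closure_subset => _ ->.
by right; rewrite (closure_id G).1//; apply: closure_subset => _ ->.
Qed.

Lemma closed_dimlt0 Z : closed Z -> dimlt Z 0 -> Z = set0.
Proof.
move=> cZ Z0; rewrite -subset0 => x Zx; apply: Z0.
exists (fun=> closure [set x]); split.
  by split=> // i _; split; [exact: closed_closure|exact: irreducible_closure1].
by rewrite (closure_id Z).1//; apply: closure_subset => _ ->.
Qed.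

Lemma dimlt_set0 k : dimlt set0 k.
Proof.
by move=> [C [[Ccl _] C0]]; have [_ [[x /C0]]] := Ccl k (leqnn k).
Qed.

(* Each irreducible component of [Z] not contained in [B] contains a test
   point outside [B]; avoiding the test points lowers the dimension. *)
Lemma dimlt_test_points (Z B : set T) k : closed Z -> dimlt Z k.+1 -> dimlt B k ->
  exists s : seq T, (forall x, x \in s -> ~ B x) /\
    forall B', closed B' -> B' `<=` Z -> (forall x, x \in s -> ~ B' x) ->
      dimlt B' k.
Proof.
move=> cZ Zk Bk; have [A [Afin AP AE]] := noetherian_irreducible_components cZ.
have [[x0 _]|T0] := pselect (exists x : T, True); last first.
  exists [::]; split=> // B' _ _ _; apply: dimlt_sub (dimlt_set0 (k := k)).
  by move=> x _; apply: T0; exists x.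
have /choice[h hP] : forall W, exists x, ~ W `<=` B -> W x /\ ~ B x.
  move=> W; have [WB|WB] := pselect (W `<=` B); first by exists x0.
  have /existsNP[x /not_implyP[Wx Bx]] := WB.
  by exists x.
have /finite_seqP[s sE] : finite_set (h @` [set W | A W /\ ~ W `<=` B]).
  by apply: finite_image; apply: sub_finite_set Afin => W [].
have sP x : x \in s -> exists W, [/\ A W, ~ W `<=` B & h W = x].
  move=> xs; have : [set` s] x by [].
  by rewrite -sE => -[W [AW WB] <-]; exists W.
exists s; split=> [x /sP[W [_ /hP[_ + <-]]]//|B' cB' B'Z B's [C [[Ccl Clt] CB']]].
have [W [AW CW]] : exists W, A W /\ C k `<=` W.
  apply: irreducible_sub_bigcup => //; first exact: (Ccl _ (leqnn k)).2.
    by move=> W /AP[].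
  by rewrite -AE => x /CB'/B'Z.
have [WB|WB] := pselect (W `<=` B).
  by apply: Bk; exists C; split=> // x /CW/WB.
have hs : h W \in s.
  have : [set` s] (h W) by rewrite -sE; exists W.
  by [].
have [Wh _] := hP _ WB.
(* Adding [W] on top of the chain in [B'] gives a longer chain in [Z]; the last inclusion is strict
   because the test point of [W] is not in [B']. *)
apply: Zk; exists (fun i => if (i <= k)%N then C i else W); split; last first.
  by rewrite ltnn AE => x Wx; exists W.
split=> i ik.
  by case: ifP => [/Ccl//|_]; exact: AP.
have ik' : (i <= k)%N by []. rewrite ik'; case: ifP => [/Clt//|].
move=> /negbT; rewrite -ltnNge ltnS => ki.
have -> : i = k by apply/eqP; rewrite eqn_leq ik' ki.
split=> // WC; apply: (B's _ hs); apply: CB'; exact: WC.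
Qed.

End NoetherianSpaces.

(** * The reduction of Eisenbud and Evans *)

Lemma exists_maximal_ideal (R : comPzRingType) (I : set R) :
  is_ideal I -> ~ I 1 -> exists m, is_maximal_ideal m /\ I `<=` m.
Proof.
move=> Iid I1.
pose P (J : set R) := [/\ is_ideal J, ~ J 1 & I `<=` J].
have [m [[mid m1 Im] mmax]] : exists m, P m /\ forall J, P J -> m `<=` J -> J `<=` m.
  pose T := {J : set R | P J}.
  pose le (J K : T) := `[< sval J `<=` sval K >].
  have [|||[m Pm] mmax] := @ZL_preorder T (exist _ I (And3 Iid I1 (fun x h => h))) le.
  - by move=> J; apply/asboolP.
  - by move=> J K L /asboolP JK /asboolP KL; apply/asboolP => x /JK/KL.
  - move=> A Atot; have [[J0 AJ0]|A0] := pselect (exists J, A J); last first.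
      exists (exist _ I (And3 Iid I1 (fun x h => h))) => J AJ.
      by case: A0; exists J.
    have PU : P (\bigcup_(J in A) sval J).
      split.
      + split.
        * by exists J0 => //; case: J0 {AJ0} => /= ? [[]].
        * move=> x y [J AJ Jx] [K AK Ky].
          have [/asboolP JK|/asboolP KJ] := Atot _ _ AJ AK.
            exists K => //; case: K AK Ky JK => K /= [[_ KD _] _ _] _ Ky JK.
            by apply: KD => //; exact: JK.
          exists J => //; case: J AJ Jx KJ => J /= [[_ JD _] _ _] _ Jx KJ.
          by apply: JD => //; exact: KJ.
        * move=> a x [J AJ Jx]; exists J => //.
          by case: J {AJ} Jx => J /= [[_ _ JM] _ _]; exact: JM.
      + by move=> [[J [? J1 ?]] _].
      + by move=> x Ix; exists J0 => //; case: J0 {AJ0} => J /= [_ _]; apply.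
    by exists (exist _ _ PU) => J AJ; apply/asboolP => x Jx; exists J.
  exists m; split=> // J PJ mJ.
  by have /(_ (asboolT mJ))/asboolP := mmax (exist _ J PJ).
exists m; split=> //; split=> // J Jid J1 mJ.
by apply/seteqP; split=> //; apply: mmax => //; split=> // x /Im/mJ.
Qed.

(** Chinese remainder theorem: [f x] is a product of elements of the other ideals, each congruent to
    1 modulo [pt x]. *)
Lemma maximal_ideals_indicator (R : comPzRingType) (T : choiceType)
    (pt : T -> set R) (s : seq T) :
  (forall x, is_maximal_ideal (pt x)) -> injective pt ->
  exists f : T -> R, forall x y, x \in s -> y \in s -> pt y (f x - (x == y)%:R).
Proof.
move=> ptmax ptinj.
suff /choice[f fP] : forall x, exists a, pt x (1 - a) /\
    forall y, y \in s -> x != y -> pt y a.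
  exists f => x y _ ys; have [fx1 fx0] := fP x.
  have [<-|xy] := eqVneq x y; last by rewrite subr0; exact: fx0.
  have [[_ _ xM] _ _] := ptmax x.
  by rewrite -opprB -mulN1r; exact: xM.
move=> x; have [[x0 xD xM] x1 xmax] := ptmax x.
elim: s => [|z s [a [xa sa]]]; first by exists 1; rewrite subrr.
have [xz|xz] := eqVneq x z.
  exists a; split=> // y; rewrite inE => /orP[/eqP ->|]; last exact: sa.
  by rewrite xz eqxx.
have [[z0 zD zM] z1 zmax] := ptmax z.
have nzx : ~ pt z `<=` pt x.
  by move=> /(zmax _ (And3 x0 xD xM) x1)/ptinj e; rewrite e eqxx in xz.
have [u [b [xu zb ub]]] := maximal_ideal_comaximal (ptmax x) (And3 z0 zD zM) nzx.
exists (a * b); split.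
  have -> : 1 - a * b = (1 - a) + a * u.
    have uE : u = 1 - b by rewrite -ub addrK.
    by rewrite uE mulrBr mulr1 addrA subrK.
  by apply: xD => //; exact: xM.
move=> y; rewrite inE => /orP[/eqP -> _|ys xy]; first exact: zM.
by rewrite mulrC; case: (ptmax y) => -[_ _ yM] _ _; apply/yM/sa.
Qed.

Section EisenbudEvans.
Variables (R : comPzRingType) (E : pzRingType) (iota : algStr R E).
Variable N : lmodType E.
Hypothesis Nfg : exists n (e : 'I_n -> N), forall v, exists c : 'I_n -> R,
  v = \sum_i iota (c i) *: e i.
Hypothesis Nfaithful : forall b : E, (forall v : N, b *: v = 0) -> b = 0.

Variables (T : topologicalType) (pt : T -> set R).
Hypothesis noethT : noetherian_space T.
Hypothesis ptmax : forall x, is_maximal_ideal (pt x).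
Hypothesis ptinj : injective pt.
Hypothesis ptclosed : forall r, closed [set x | pt x r].

Definition mx_bad p q (X : 'M[E]_(p, q)) (j : nat) : set T :=
  [set x | ~ mx_rank_at iota (pt x) X j].

(** The locus is cut out by the scalars [r] whose scalar matrix is a compression of [X]. *)
Lemma closed_mx_bad p q (X : 'M[E]_(p, q)) j : closed (mx_bad X j).
Proof.
pose G : set R := [set r | exists C D, C *m X *m D = cmx iota j r].
have -> : mx_bad X j = \bigcap_(r in G) [set x | pt x r].
  apply/seteqP; split=> x /= xX.
    move=> r [C [D CD]]; apply: contrapT => xr; apply: xX.
    by exists C, D, r.
  by move=> [C [D [r [xr CD]]]]; apply: xr; apply: xX; exists C, D.
by apply: closed_bigI => r _; exact: ptclosed.
Qed.

Lemma mx_rank_at0 p q (X : 'M[E]_(p, q)) x : mx_rank_at iota (pt x) X 0.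
Proof.
exists 0, 0, 1; split; first by case: (ptmax x).
by apply/matrixP => -[].
Qed.

(** It suffices to keep the largest rank [j <= p]; truncation gives the smaller ones. *)
Lemma mx_rank_at_keep_all p q (X : 'M[E]_(p, q)) (x : 'rV_q) y :
  exists a : 'cV_p, forall j, (j <= p)%N ->
    mx_rank_at iota (pt y) (col_mx X x) j ->
    mx_rank_at iota (pt y) (X + a *m x) j.
Proof.
pose P j := (j <= p)%N && `[< mx_rank_at iota (pt y) (col_mx X x) j >].
have P0 : P 0%N by apply/andP; split=> //; apply/asboolP; exact: mx_rank_at0.
have Pp j : P j -> (j <= p)%N by case/andP.
have exP : exists j, P j by exists 0%N.
case: (ex_maxnP exP Pp) => i /andP[ip /asboolP iX] imax.
have [a aP] := mx_rank_at_keep Nfg Nfaithful (ptmax y) ip iX.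
exists a => j jp jX; apply: mx_rank_at_le aP.
by apply: imax; rewrite /P jp; apply/asboolP.
Qed.

(** The new bad locus for [j] lies in the old one for [j.+1], whose dimension bound is one too
    large. Keeping the ranks at test points of the latter outside the old locus for [j] gains the
    missing one. *)
Lemma mx_bad_reduce t p q (X : 'M[E]_(p, q)) (x : 'rV_q) : (t <= p)%N ->
  (forall j, (j <= p.+1)%N -> dimlt (mx_bad (col_mx X x) j) (j - t)) ->
  exists a : 'cV_p, forall j, (j <= p)%N -> dimlt (mx_bad (X + a *m x) j) (j - t).
Proof.
move=> tp bX.
have bad_drop a j : mx_bad (X + a *m x) j `<=` mx_bad (col_mx X x) j.+1.
  move=> y yj h; apply: yj.
  exact: (mx_rank_at_drop Nfg Nfaithful (ptmax y) _ h).
have /choice[s sP] : forall j, exists s : seq T, (t <= j <= p)%N ->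
    (forall y, y \in s -> ~ mx_bad (col_mx X x) j y) /\
    forall B', closed B' -> B' `<=` mx_bad (col_mx X x) j.+1 ->
      (forall y, y \in s -> ~ B' y) -> dimlt B' (j - t).
  move=> j; have [/andP[tj jp]|] := boolP (t <= j <= p)%N; last by exists [::].
  have [|s sP] := dimlt_test_points noethT (@closed_mx_bad _ _ (col_mx X x) j.+1) _
    (bX j (leqW jp)).
    by rewrite -subSn//; exact: bX.
  by exists s.
pose L := undup (flatten [seq s j | j <- seq.iota 0 p.+1]).
have sL j y : (j <= p)%N -> y \in s j -> y \in L.
  move=> jp ys; rewrite mem_undup; apply/flattenP; exists (s j) => //.
  by apply: map_f; rewrite mem_iota add0n.
have [f fP] := maximal_ideals_indicator L ptmax ptinj.
have /choice[c cP] := mx_rank_at_keep_all X x.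
pose l := tnth (in_tuple L).
have linj : injective l by apply/tuple_uniqP; exact: undup_uniq.
(* Modulo each test point [y] this agrees with the local choice [c y]. *)
exists (\sum_i cmx iota p (f (l i)) *m c (l i)).
set b := \sum_i _.
have keep y j : y \in L -> (j <= p)%N -> mx_rank_at iota (pt y) (col_mx X x) j ->
    mx_rank_at iota (pt y) (X + b *m x) j.
  move=> yL jp yj.
  apply: (@mx_rank_at_perturb _ _ _ _ Nfg Nfaithful _ (ptmax y) _ _ X x (c y) b j
    _ (fun i => f (l i) - (l i == y)%:R) (c \o l)) => [i||]; last exact: cP.
    by apply: fP => //; exact: mem_tnth.
  have [i0 i0E] : exists i0, y = l i0 by apply/tnthP.
  transitivity (c y + (b - c y)); first by rewrite addrCA subrr addr0.
  congr (_ + _).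
  have -> : c y = \sum_i cmx iota p (l i == y)%:R *m c (l i).
    rewrite (bigD1 i0)//= -i0E eqxx big1 ?addr0.
      by rewrite /cmx rmorph1 mul1mx.
    move=> i ii0; suff /negPf -> : l i != y by rewrite /cmx !rmorph0 mul0mx.
    by apply: contra ii0 => /eqP; rewrite i0E => /linj ->.
  rewrite -sumrB; apply: eq_bigr => i _.
  by rewrite -mulmxBl; congr (_ *m _); rewrite /cmx rmorphB raddfB.
(* For j < t the truncated bound for [j.+1] is already 0, so the old locus is empty. *)
move=> j jp; have [tj|jt] := leqP t j; last first.
  have -> : mx_bad (X + b *m x) j = set0; last exact: dimlt_set0.
  rewrite -subset0 => y /bad_drop.
  suff -> : mx_bad (col_mx X x) j.+1 = set0 by [].
  apply: closed_dimlt0; first exact: closed_mx_bad.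
  by have := bX j.+1 jp; rewrite (eqP jt).
have [|sB sD] := sP j; first by rewrite tj.
apply: sD; first exact: closed_mx_bad; first exact: bad_drop.
move=> y ys; apply; apply: keep => //; first exact: sL ys.
by apply: contrapT; exact: sB.
Qed.

(** Each reduction merges the last row into the others; once [t] rows are left, the bound for j = t
    says that the bad locus is empty. *)
Lemma mx_bad_compress t k p q (X : 'M[E]_(p, q)) : p = (t + k)%N ->
  (forall j, (j <= p)%N -> dimlt (mx_bad X j) (j - t)) ->
  exists A : 'M_(t, p), mx_bad (A *m X) t = set0.
Proof.
elim: k p X => [|k IH] p X; rewrite ?addn0 ?addnS => pE bX.
  subst p; exists 1%:M; rewrite mul1mx; apply: closed_dimlt0 => //.
    exact: closed_mx_bad.
  by rewrite -(subnn t); exact: bX.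
have {}pE : p = (t + k + 1)%N by rewrite addn1.
subst p; have [||a aP] := @mx_bad_reduce t _ _ (usubmx X) (dsubmx X).
- exact: leq_addr.
- by rewrite vsubmxK -addn1.
have [A AP] := IH _ _ erefl aP.
exists (A *m row_mx 1%:M a).
by rewrite -mulmxA -(vsubmxK X) mul_row_col mul1mx.
Qed.

Lemma mx_split t d p q (X : 'M[E]_(p, q)) :
  dimlt [set: T] d.+1 ->
  (forall x, mx_rank_at iota (pt x) X (t + d)) ->
  (forall m, is_maximal_ideal m -> ~ (exists x, pt x = m) ->
    exists r, ~ m r /\ iota r = 0) ->
  exists (A : 'M_(t, p)) (D : 'M_(q, t)), A *m X *m D = 1%:M.
Proof.
move=> Td Xr out.
(* The zero rows only ensure that there are at least [t] rows. *)
pose X' : 'M[E]_(p + t, q) := col_mx X 0.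
have X'r x : mx_rank_at iota (pt x) X' (t + d).
  have [C [D [r [xr CD]]]] := Xr x.
  by exists (row_mx C 0), D, r; rewrite mul_row_col mulmx0 addr0.
have [j _|A AE] := @mx_bad_compress t p _ _ X' (addnC _ _).
  (* Up to t + d there are no bad points; beyond it j - t is at least [d.+1], which bounds the whole
     space. *)
  have [jtd|jtd] := leqP j (t + d).
    have -> : mx_bad X' j = set0; last exact: dimlt_set0.
    rewrite -subset0 => x; apply.
    by apply: mx_rank_at_le (X'r x).
  apply: (@dimlt_le _ _ d.+1); first by
    rewrite leq_subRL ?addnS// (leq_trans _ (ltnW jtd)) ?leq_addr.
  exact: dimlt_sub Td.
(* [I] lies in no maximal ideal: at a point of [T] the compression has full rank, and elsewhere a
   scalar outside the ideal is zero in [E]. *)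
pose I : set R := [set r | exists D, A *m X' *m D = cmx iota t r].
have Iid : is_ideal I.
  split.
  - by exists 0; rewrite mulmx0 /cmx rmorph0 raddf0.
  - move=> r r' [D DE] [D' DE']; exists (D + D').
    by rewrite mulmxDr DE DE' /cmx rmorphD raddfD.
  - move=> a r [D DE]; exists (D *m cmx iota t a).
    by rewrite mulmxA DE -mul_cmx /cmx rmorphM scalar_mxM.
have [D DE] : I 1.
  apply: contrapT => /(exists_maximal_ideal Iid)[m [mmax Im]].
  have [[x xm]|nx] := pselect (exists x, pt x = m).
    have [|D [r [xr DE]]] := @mx_rank_at_square _ _ _ _ Nfg Nfaithful _ (ptmax x) _ _ (A *m X').
      apply: contrapT => xX; suff : (set0 : set T) x by [].
      by rewrite -AE.
    by apply: xr; rewrite xm; apply: Im; exists D.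
  have [r [mr r0]] := out m mmax nx.
  by apply: mr; apply: Im; exists 0; rewrite mulmx0 /cmx r0 raddf0.
exists (lsubmx A), D; move: DE; rewrite /cmx rmorph1 => <-.
by rewrite -[A in RHS]hsubmxK mul_row_col mulmx0 addr0.
Qed.

End EisenbudEvans.

(** * Splittings and their suprema *)

Section LinearMaps.
Variables (A : pzRingType).

Definition mk_linear (U V : lmodType A) (f : U -> V) (h : linear f) : {linear U -> V} :=
  HB.pack f (GRing.isLinear.Build A U V _ f h).

Definition splits (V W : lmodType A) (t : nat) : Prop :=
  exists (F : 'I_t -> {linear V -> W}) (G : 'I_t -> {linear W -> V}),
    forall i j w, F i (G j w) = if i == j then w else 0.

Lemma split_surjectiveP (V W : lmodType A) t :
  (exists f : {linear V -> {ffun 'I_t -> W}}, split_surjective f) <-> splits V W t.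
Proof.
split=> [[f [_ [g fg]]]|[F [G FG]]].
  have Fl i : linear (fun v => f v i) by move=> a x y; rewrite linearP !ffunE.
  have Gl j : linear (fun w => g [ffun k => if k == j then w else 0]).
    move=> a x y; rewrite -linearP; congr (g _); apply/ffunP => k.
    by rewrite !ffunE; case: ifP; rewrite ?scaler0 ?addr0.
  exists (fun i => mk_linear (Fl i)), (fun j => mk_linear (Gl j)) => i j w /=.
  by rewrite fg ffunE.
have fl : linear (fun v => [ffun i => F i v]).
  by move=> a x y; apply/ffunP => i; rewrite !ffunE linearP.
have gl : linear (fun w : {ffun 'I_t -> W} => \sum_j G j (w j)).
  move=> a x y; rewrite scaler_sumr -big_split; apply: eq_bigr => j _ /=.
  by rewrite !ffunE linearP.
have fg (w : {ffun 'I_t -> W}) : [ffun i => F i (\sum_j G j (w j))] = w.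
  apply/ffunP => i; rewrite ffunE linear_sum (bigD1 i)//= FG eqxx big1 ?addr0//.
  by move=> j ji; rewrite FG eq_sym (negPf ji).
exists (mk_linear fl); split; last by exists (mk_linear gl).
by move=> w; exists (\sum_j G j (w j)); exact: fg.
Qed.

Lemma splits_le (V W : lmodType A) t t' : (t' <= t)%N -> splits V W t -> splits V W t'.
Proof.
move=> le [F [G FG]].
exists (fun i => F (widen_ord le i)), (fun i => G (widen_ord le i)) => i j w.
by rewrite FG -(inj_eq val_inj).
Qed.

Lemma splits0 (V W : lmodType A) : splits V W 0.
Proof. by do 2![unshelve eexists; first by case=> []]; case. Qed.

End LinearMaps.

Section Suprema.

Lemma supremum_nat (P : set nat) : P !=set0 ->
  (exists d, [/\ P d, forall n, P n -> (n <= d)%N &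
     supremum -oo%E [set n%:Z%:E | n in P] = d%:Z%:E :> \bar int]) \/
  ((forall d, exists2 n, P n & (d <= n)%N) /\
     supremum -oo%E [set n%:Z%:E | n in P] = +oo%E :> \bar int).
Proof.
move=> [n0 Pn0]; set A := [set _ | n in P].
have A0 : A != set0 by apply/set0P; exists n0%:Z%:E, n0.
have supE y : supremums A y -> supremum -oo%E A = y.
  move=> Ay; rewrite /supremum (negPf A0).
  by apply: xget_subset1 => //; exact: is_subset1_supremums.
have [[b bP]|nb] := pselect (exists b, forall n, P n -> (n <= b)%N).
  have exP : exists n, `[< P n >] by exists n0; apply/asboolP.
  have bP' n : `[< P n >] -> (n <= b)%N by move=> /asboolP/bP.
  case: (ex_maxnP exP bP') => d /asboolP Pd dmax; left; exists d.
  have dle n : P n -> (n <= d)%N by move=> Pn; apply: dmax; apply/asboolP.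
  split=> //; apply: supE; split=> [_ [n Pn <-]|y]; last by apply; exists d.
  by rewrite lee_fin lez_nat dle.
right; split.
  move=> d; apply: contrapT => nd; apply: nb; exists d => n Pn.
  by rewrite leqNgt; apply/negP => dn; apply: nd; exists n => //; exact: ltnW.
apply: supE; split=> [_ [n _ <-]|y yub]; first exact: leey.
case: y yub => [z zub||yub].
- have [n Pn zn] : exists2 n, P n & z < n%:Z.
    apply: contrapT => nz; apply: nb; exists `|z|%N => n Pn.
    rewrite leqNgt; apply/negP => zn; apply: nz; exists n => //.
    by rewrite (le_lt_trans (ler_norm z))// -abszE ltz_nat.
  have : (n%:Z%:E <= z%:E)%E by apply: zub; exists n.
  by rewrite lee_fin leNgt zn.
- by rewrite lexx.
- by have := yub _ (ex_intro2 _ _ n0 Pn0 erefl).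
Qed.

Variable A : pzRingType.

(** A finite supremum of naturals is attained, and splittings can be truncated. *)
Lemma le_spl (V W : lmodType A) t : (t%:Z%:E <= spl V W)%E <-> splits V W t.
Proof.
have splE : [set t : nat | exists f : {linear V -> {ffun 'I_t -> W}}, split_surjective f] =
    [set t : nat | splits V W t].
  by apply/seteqP; split=> n /= /split_surjectiveP.
rewrite /spl splE.
have [|[d [Pd dmax ->]]|[nb ->]] := @supremum_nat [set t | splits V W t].
- by exists 0%N; exact: splits0.
- rewrite lee_fin lez_nat; split=> [td|/dmax//]; exact: splits_le Pd.
- split=> [_|_]; last exact: leey.
  by have [n Pn tn] := nb t; exact: splits_le Pn.
Qed.

Lemma spl_nat_or_pinfty (V W : lmodType A) :
  (exists d : nat, spl V W = d%:Z%:E) \/ spl V W = +oo%E.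
Proof.
have [|[d [_ _ dE]]|[_ dE]] := @supremum_nat
  [set t : nat | exists f : {linear V -> {ffun 'I_t -> W}}, split_surjective f].
- by exists 0%N; apply/split_surjectiveP; exact: splits0.
- by left; exists d.
- by right.
Qed.

Lemma spl_pinfty (V W : lmodType A) :
  spl V W = +oo%E <-> forall t, splits V W t.
Proof.
split=> [e t|sp]; first by apply/le_spl; rewrite e leey.
have [[d dE]|//] := spl_nat_or_pinfty V W.
by have /le_spl := sp d.+1; rewrite dE lee_fin lez_nat ltnn.
Qed.

End Suprema.

(** The point [x] gives a chain of length 0, which rules out the value -oo. *)
Lemma krull_dim_dimlt (T : topologicalType) : (krull_dim T < +oo)%E ->
  forall x : T, exists d : nat, krull_dim T = d%:Z%:E /\ dimlt [set: T] d.+1.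
Proof.
rewrite /krull_dim => dT x.
have [|[d [_ dmax dE]]|[_ dE]] := @supremum_nat [set n | exists Z, @closed_chain T n Z].
- exists 0%N; exists (fun=> closure [set x]); split=> // i _.
  by split; [exact: closed_closure|exact: irreducible_closure1].
- by exists d; split=> // -[C [CC _]]; have := dmax d.+1 (ex_intro _ C CC); rewrite ltnn.
- by rewrite dE in dT.
Qed.

(** * The endomorphism ring *)

Section EndomorphismRing.
Variables (A : pzRingType) (N : lmodType A).

Record endo : Type := Endo { endo_fun :> N -> N; endo_linear : linear endo_fun }.
HB.instance Definition _ := gen_eqMixin endo.
HB.instance Definition _ := gen_choiceMixin endo.
HB.instance Definition _ (f : endo) := GRing.isLinear.Build A N N _ f (endo_linear f).

Lemma endoP (f g : endo) : (forall x, f x = g x) -> f = g.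
Proof.
case: f g => [f fl] [g gl] /= fg; have {}fg : f = g by exact/funext.
by subst g; congr Endo; exact: Prop_irrelevance.
Qed.

Fact endo0_linear : linear (fun _ : N => 0 : N).
Proof. by move=> a x y; rewrite scaler0 addr0. Qed.
Fact endoN_linear (f : endo) : linear (fun x => - f x).
Proof. by move=> a x y; rewrite linearP opprD scalerN. Qed.
Fact endoD_linear (f g : endo) : linear (fun x => f x + g x).
Proof. by move=> a x y; rewrite !linearP scalerDr addrACA. Qed.
Fact endo1_linear : linear (fun x : N => x).
Proof. by []. Qed.
Fact endoM_linear (f g : endo) : linear (fun x => f (g x)).
Proof. by move=> a x y; rewrite !linearP. Qed.

Definition endo0 := Endo endo0_linear.
Definition endoN f := Endo (endoN_linear f).
Definition endoD f g := Endo (endoD_linear f g).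
Definition endo1 := Endo endo1_linear.
Definition endoM f g := Endo (endoM_linear f g).

Fact endo_addA : associative endoD.
Proof. by move=> f g h; apply: endoP => x /=; rewrite addrA. Qed.
Fact endo_addC : commutative endoD.
Proof. by move=> f g; apply: endoP => x /=; rewrite addrC. Qed.
Fact endo_add0 : left_id endo0 endoD.
Proof. by move=> f; apply: endoP => x /=; rewrite add0r. Qed.
Fact endo_addN : left_inverse endo0 endoN endoD.
Proof. by move=> f; apply: endoP => x /=; rewrite addNr. Qed.
HB.instance Definition _ := GRing.isZmodule.Build endo
  endo_addA endo_addC endo_add0 endo_addN.

Fact endo_mulA : associative endoM. Proof. by move=> f g h; apply: endoP. Qed.
Fact endo_mul1 : left_id endo1 endoM. Proof. by move=> f; apply: endoP. Qed.
Fact endo_mulr1 : right_id endo1 endoM. Proof. by move=> f; apply: endoP. Qed.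
Fact endo_mulDl : left_distributive endoM +%R.
Proof. by move=> f g h; apply: endoP. Qed.
Fact endo_mulDr : right_distributive endoM +%R.
Proof. by move=> f g h; apply: endoP => x /=; rewrite linearD. Qed.
HB.instance Definition _ := GRing.Zmodule_isPzRing.Build endo
  endo_mulA endo_mul1 endo_mulr1 endo_mulDl endo_mulDr.

Lemma endo_sumE (I : Type) (r : seq I) (P : pred I) (f : I -> endo) x :
  (\sum_(i <- r | P i) f i) x = \sum_(i <- r | P i) f i x.
Proof. by elim/big_rec2: _ => [//|i y z _ <-]. Qed.

(** A copy of [N] for the action of its endomorphisms, apart from its structure over [A]. *)
Definition endo_mod : Type := N.
HB.instance Definition _ := GRing.Zmodule.on endo_mod.

Definition endo_scale (f : endo) (x : endo_mod) : endo_mod := f x.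
Fact endo_scaleA f g x : endo_scale f (endo_scale g x) = endo_scale (f * g) x.
Proof. by []. Qed.
Fact endo_scale1 : left_id 1 endo_scale. Proof. by []. Qed.
Fact endo_scaleDr : right_distributive endo_scale +%R.
Proof. by move=> f x y; rewrite /endo_scale linearD. Qed.
Fact endo_scaleDl x : {morph endo_scale^~ x : f g / f + g}. Proof. by []. Qed.
HB.instance Definition _ := GRing.Zmodule_isLmodule.Build endo endo_mod
  endo_scaleA endo_scale1 endo_scaleDr endo_scaleDl.

Lemma endo_mod_faithful (f : endo) : (forall v : endo_mod, f *: v = 0) -> f = 0.
Proof. by move=> f0; apply: endoP => x; exact: f0. Qed.

End EndomorphismRing.

Section CentralAction.
Variables (R : comPzRingType) (S : pzRingType) (phi : algStr R S).

Lemma phi_scaleC (M : rmodType S) r (s : S^c) (x : M) :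
  (phi r : S^c) *: (s *: x) = s *: ((phi r : S^c) *: x).
Proof. by rewrite !scalerA; congr (_ *: _); exact: (esym (alg_central phi r s)). Qed.

Lemma phi_scaleM (M : rmodType S) a b (x : M) :
  (phi (a * b) : S^c) *: x = (phi a : S^c) *: ((phi b : S^c) *: x).
Proof. by rewrite scalerA mulrC rmorphM. Qed.

Lemma phi_scaleD (M : rmodType S) a b (x : M) :
  (phi (a + b) : S^c) *: x = (phi a : S^c) *: x + (phi b : S^c) *: x.
Proof. by rewrite rmorphD; exact: scalerDl. Qed.

Lemma phi_scale1 (M : rmodType S) (x : M) : (phi 1 : S^c) *: x = x.
Proof. by rewrite rmorph1; exact: scale1r. Qed.

Lemma phi_scale_linear (M : rmodType S) r : linear (fun x : M => (phi r : S^c) *: x).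
Proof. by move=> a x y; rewrite scalerDr phi_scaleC. Qed.

Variable N : rmodType S.

Definition endo_phi (r : R) : endo N := Endo (@phi_scale_linear N r).

Fact endo_phi_zmod : zmod_morphism endo_phi.
Proof.
move=> a b; apply: endoP => x /=.
by apply/eqP; rewrite eq_sym subr_eq -phi_scaleD subrK.
Qed.
Fact endo_phi_monoid : monoid_morphism endo_phi.
Proof.
by split=> [|a b]; apply: endoP => x /=; [exact: phi_scale1|exact: phi_scaleM].
Qed.
HB.instance Definition _ := GRing.isZmodMorphism.Build R (endo N) endo_phi endo_phi_zmod.
HB.instance Definition _ := GRing.isMonoidMorphism.Build R (endo N) endo_phi endo_phi_monoid.

Fact endo_phi_central r (f : endo N) : endo_phi r * f = f * endo_phi r.
Proof. by apply: endoP => x /=; rewrite linearZ. Qed.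

Definition endo_alg : algStr R (endo N) := AlgStr endo_phi_central.

Hypothesis S_module_finite : finitely_generated (algMod phi).
Hypothesis N_fp : finitely_presented N.

(** Generators of [N] over [S] times generators of [S] over [R]. *)
Lemma endo_mod_fg : exists n (e : 'I_n -> endo_mod N), forall v,
  exists c : 'I_n -> R, v = \sum_i endo_alg (c i) *: e i.
Proof.
have [k [s sP]] := S_module_finite; have [_ [n [_ [f [fsurj _]]]]] := N_fp.
pose h (x : 'I_n * 'I_k) : N := (s x.2 : S^c) *: f (delta_mx 0 x.1).
exists #|{: 'I_n * 'I_k}|, (fun i => h (enum_val i)) => v.
have [x <-] := fsurj v.
have /choice[c cP] : forall i, exists c : 'I_k -> R, x 0 i = \sum_j (c j *: s j : algMod phi).
  by move=> i; have [c cE] := sP (x 0 i); exists c.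
exists (fun i => c (enum_val i).1 (enum_val i).2).
rewrite -(reindex (@enum_val _ {: 'I_n * 'I_k}) (P := xpredT)
  (F := fun y : 'I_n * 'I_k => endo_alg (c y.1 y.2) *: (h y : endo_mod N)))/=; last first.
  exact/onW_bij/enum_val_bij.
rewrite -(pair_bigA _ (fun i j => endo_alg (c i j) *: (h (i, j) : endo_mod N)))/=.
rewrite [x in LHS]row_sum_delta linear_sum; apply: eq_bigr => i _.
rewrite linearZ /= cP scaler_suml; apply: eq_bigr => j _.
transitivity ((phi (c i j) : S^c) *: ((s j : S^c) *: f (delta_mx 0 i))); last by [].
rewrite [RHS]scalerA.
exact: (congr1 (fun z : S^c => z *: f (delta_mx 0 i)) (alg_central phi _ _)).
Qed.

End CentralAction.

(** * Localization *)

Section Localization.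
Variables (R : comPzRingType) (S : pzRingType) (phi : algStr R S) (p : Spec R).

Local Notation "r ⋅ x" := ((phi r : S^c) *: x) (at level 40, left associativity).

Lemma den_prod (I : finType) (P : pred I) (u : I -> denom p) :
  exists d : denom p, den d = \prod_(i | P i) den (u i).
Proof.
elim/big_rec: _ => [|i r _ [d dE]]; first by exists (denom1 p).
by exists (denomM (u i) d); rewrite /= dE.
Qed.

Lemma common_denom (I : finType) (u : I -> denom p) :
  exists (d : denom p) (c : I -> denom p), forall i, den d = den (c i) * den (u i).
Proof.
have [d dE] := den_prod xpredT u.
have /choice[c cE] : forall i, exists c : denom p,
    den c = \prod_(j | j != i) den (u j) by move=> i; exact: den_prod.
by exists d, c => i; rewrite dE (bigD1 i)//= cE mulrC.
Qed.

Section Modules.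
Variables (M : rmodType S).

Lemma mfrac_cancel (x : M) (u v : denom p) w :
  den v = w * den u -> mfrac phi x u = mfrac phi (w ⋅ x) v.
Proof.
move=> vE; apply/mfrac_eq; exists (denom1 p); rewrite !mul1r vE.
by rewrite mulrC phi_scaleM.
Qed.

Lemma mfracD1 (x y : M) (u : denom p) : mfrac phi (x + y) u = mfrac phi x u + mfrac phi y u.
Proof.
rewrite mfracD; apply/mfrac_eq; exists (denom1 p); rewrite /= !mul1r -scalerDr.
by rewrite -phi_scaleM.
Qed.

Lemma mfrac0 (u : denom p) : mfrac phi (0 : M) u = 0.
Proof. by apply: (addrI (mfrac phi (0 : M) u)); rewrite -mfracD1 !addr0. Qed.

Lemma mfrac_sum (I : Type) (r : seq I) (P : pred I) (f : I -> M) (u : denom p) :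
  mfrac phi (\sum_(i <- r | P i) f i) u = \sum_(i <- r | P i) mfrac phi (f i) u.
Proof.
elim/big_rec2: _ => [|i y x _ <-]; first exact: mfrac0.
exact: mfracD1.
Qed.

Lemma mfrac_eq0 (x : M) (u : denom p) : mfrac phi x u = 0 <-> exists w : denom p, den w ⋅ x = 0.
Proof.
rewrite -(mfrac0 u); split=> [/mfrac_eq|] [w].
  by rewrite scaler0 => e; exists (denomM w u).
move=> e; apply/mfrac_eq; exists w.
by rewrite mulrC phi_scaleM e !scaler0.
Qed.

Lemma scale_mfrac s u (x : M) v :
  (sfrac phi s u : (locRing phi p)^c) *: mfrac phi x v =
  mfrac phi ((s : S^c) *: x) (denomM u v).
Proof. exact: loc_scaleE. Qed.

Lemma scale_mfrac1 s (x : M) v :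
  (sfrac phi s (denom1 p) : (locRing phi p)^c) *: mfrac phi x v =
  mfrac phi ((s : S^c) *: x) v.
Proof.
rewrite scale_mfrac; apply/mfrac_eq; exists (denom1 p) => /=.
by rewrite !mul1r.
Qed.

End Modules.

(** Linearity over [S], which acts on the localized module through the fractions s/1. *)
Definition loc_linear (U W : rmodType S) (psi : U -> locMod phi p W) : Prop :=
  forall (a : S^c) x y, psi (a *: x + y) =
    (sfrac phi a (denom1 p) : (locRing phi p)^c) *: psi x + psi y.

Lemma loc_linear_comp (U V W : rmodType S) (psi : V -> locMod phi p W)
  (f : {linear U -> V}) : loc_linear psi -> loc_linear (psi \o f).
Proof. by move=> psil a x y; rewrite /= linearP psil. Qed.

Lemma loc_linear_mfrac (V W : rmodType S)
    (f : {linear locMod phi p V -> locMod phi p W}) :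
  loc_linear (fun x => f (mfrac phi x (denom1 p))).
Proof. by move=> a x y; rewrite mfracD1 -scale_mfrac1 linearP. Qed.

Lemma loc_linear0 (U W : rmodType S) (psi : U -> locMod phi p W) :
  loc_linear psi -> psi 0 = 0.
Proof.
move=> psil; have := psil 1 0 0; rewrite scaler0 addr0 => h.
apply: (addrI (psi 0)); rewrite addr0 [RHS]h; congr (_ + _).
have [x [u ->]] := mfracP (psi 0).
by rewrite scale_mfrac1 scale1r.
Qed.

Lemma loc_linearD (U W : rmodType S) (psi : U -> locMod phi p W) x y :
  loc_linear psi -> psi (x + y) = psi x + psi y.
Proof.
move=> psil; have := psil 1 x y; rewrite scale1r => ->; congr (_ + _).
have [z [u ->]] := mfracP (psi x).
by rewrite scale_mfrac1 scale1r.
Qed.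

Lemma loc_linearZ (U W : rmodType S) (psi : U -> locMod phi p W) (a : S^c) x :
  loc_linear psi -> psi (a *: x) =
    (sfrac phi a (denom1 p) : (locRing phi p)^c) *: psi x.
Proof.
by move=> psil; have := psil a x 0; rewrite loc_linear0// !addr0.
Qed.

Lemma loc_linear_sum (U W : rmodType S) (psi : U -> locMod phi p W)
    (I : Type) (r : seq I) (P : pred I) (f : I -> U) :
  loc_linear psi -> psi (\sum_(i <- r | P i) f i) = \sum_(i <- r | P i) psi (f i).
Proof.
move=> psil; elim/big_rec2: _ => [|i y x _ <-]; first exact: loc_linear0.
exact: loc_linearD.
Qed.

(** Hom out of a finitely presented module commutes with localization: [d] is a common denominator
    for the images of the generators, and multiplying by [D] kills the finitely many relations, so
    that the map descends to [U]. *)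
Lemma fp_loc_linear (U W : rmodType S) (psi : U -> locMod phi p W) :
  finitely_presented U -> loc_linear psi ->
  exists (f : {linear U -> W}) (r : denom p), forall x, psi x = mfrac phi (f x) r.
Proof.
move=> [m [n [g [f [fsurj fker]]]]] psil.
have /choice[wu wuE] : forall i : 'I_n, exists wu : W * denom p,
    psi (f (delta_mx 0 i)) = mfrac phi wu.1 wu.2.
  by move=> i; have [x [u e]] := mfracP (psi (f (delta_mx 0 i))); exists (x, u).
have [d [c cE]] := common_denom (fun i => (wu i).2).
pose w i : W := den (c i) ⋅ (wu i).1.
pose F (x : 'rV[S^c]_n) : W := \sum_i x 0 i *: w i.
have Fl : linear F.
  move=> a x y; rewrite /F scaler_sumr -big_split; apply: eq_bigr => i _ /=.
  by rewrite !mxE scalerDl scalerA.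
have FE x : psi (f x) = mfrac phi (F x) d.
  rewrite [x in LHS]row_sum_delta linear_sum loc_linear_sum//= mfrac_sum.
  apply: eq_bigr => i _; rewrite linearZ /= loc_linearZ// wuE.
  by rewrite (mfrac_cancel (wu i).1 (cE i)) scale_mfrac1.
have /choice[t tE] : forall l : 'I_m, exists t : denom p, den t ⋅ F (g (delta_mx 0 l)) = 0.
  move=> l; apply/(mfrac_eq0 _ d); rewrite -FE.
  have -> : f (g (delta_mx 0 l)) = 0 by apply/fker; exists (delta_mx 0 l).
  exact: loc_linear0.
have [D [c' c'E]] := common_denom t.
have Fker x : f x = 0 -> den D ⋅ F x = 0.
  move=> /fker[y <-].
  rewrite [y]row_sum_delta linear_sum -[F _]/(mk_linear Fl _) linear_sum scaler_sumr.
  rewrite big1// => l _; rewrite !linearZ /= phi_scaleC (c'E l) phi_scaleM tE.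
  by rewrite !scaler0.
have /choice[h hE] := fsurj.
pose G x := den D ⋅ F (h x).
have GE x : G (f x) = den D ⋅ F x.
  apply/eqP; rewrite -subr_eq0 -scalerBr; apply/eqP.
  have -> : F (h (f x)) - F x = F (h (f x) - x) by exact: (esym (linearB (mk_linear Fl) _ _)).
  by apply: Fker; rewrite linearB hE subrr.
have Gl : linear G.
  move=> a x y; rewrite -(hE x) -(hE y) -linearP !GE.
  by rewrite -phi_scaleC -scalerDr; congr (_ *: _); exact: Fl.
exists (mk_linear Gl), (denomM D d) => x.
rewrite -(hE x) FE /= GE.
by apply: mfrac_cancel.
Qed.

(** * Approximation of local maps out of summands of direct sums *)

Variable N : rmodType S.

(** An infinite direct sum admits no common denominator for a whole map; what survives is agreement
    on finitely many elements. *)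
Definition approximable (U : rmodType S) : Prop :=
  forall psi : U -> locMod phi p N, loc_linear psi ->
  forall k (z : 'I_k -> U), exists (f : {linear U -> N}) (r : denom p),
    forall i, psi (z i) = mfrac phi (f (z i)) r.

Lemma approximable_summand (U W : rmodType S) :
  direct_summand U W -> approximable W -> approximable U.
Proof.
move=> [U' [f [g gf fg]]] Wapp psi psil k z.
have gl : linear (fun x : U => g (x, 0)).
  move=> a x y; apply: (can_inj gf); rewrite linearP !fg.
  by congr pair; rewrite /= ?scaler0 ?addr0.
have psi'l : loc_linear (fun w => psi (f w).1) by move=> a x y; rewrite linearP /= psil.
have [h [r hE]] := Wapp _ psi'l k (fun i => g (z i, 0)).
have hl : linear (fun x : U => h (g (x, 0))) by move=> a x y; rewrite gl linearP.
exists (mk_linear hl), r => i.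
by have := hE i; rewrite fg.
Qed.

Section DirectSums.
Variables (I : Type) (F : I -> rmodType S).

Definition dsum_inj_fun i (x : F i) : forall j, F j := fun j =>
  match pselect (i = j) with left e => ecast j (F j) e x | right _ => 0 end.

Fact dsum_inj_fin i (x : F i) : finite_set [set j | dsum_inj_fun x j != 0].
Proof.
apply: (@sub_finite_set _ _ [set i]); last exact: finite_set1.
by move=> j /=; rewrite /dsum_inj_fun; case: pselect => [//|]; rewrite eqxx.
Qed.
Definition dsum_inj i (x : F i) : dsum F := Dsum (dsum_inj_fin x).

Lemma dsum_inj_linear i : linear (@dsum_inj i).
Proof.
move=> a x y; apply: dsumP => j /=; rewrite /dsum_inj_fun.
by case: pselect => [e|_]; [case: j / e|rewrite scaler0 addr0].
Qed.

Definition dsum_cut_fun i (f : dsum F) : forall j, F j := fun j =>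
  match pselect (i = j) return F j with left _ => 0 | right _ => f j end.

Fact dsum_cut_fin i (f : dsum F) : finite_set [set j | dsum_cut_fun i f j != 0].
Proof.
apply: sub_finite_set (dsum_fin f) => j /=; rewrite /dsum_cut_fun.
by case: pselect => //; rewrite eqxx.
Qed.
Definition dsum_cut i (f : dsum F) : dsum F := Dsum (dsum_cut_fin i f).

Lemma dsum_cut_linear i : linear (dsum_cut i).
Proof.
move=> a x y; apply: dsumP => j /=; rewrite /dsum_cut_fun.
by case: pselect => _; rewrite ?scaler0 ?addr0.
Qed.

Lemma dsum_cutE i (f : dsum F) : f = dsum_inj (f i) + dsum_cut i f.
Proof.
apply: dsumP => j /=; rewrite /dsum_inj_fun /dsum_cut_fun.
by case: pselect => [e|_]; [case: j / e; rewrite addr0|rewrite add0r].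
Qed.

(** Induction on a finite set [s] containing the supports of all [z l]: the component at [i] is
    finitely presented, the rest is handled after cutting [i] off, and the two maps are added over a
    common denominator. *)
Lemma approximable_dsum :
  (forall i, finitely_presented (F i)) -> approximable (dsum F).
Proof.
move=> Ffp psi psil k z.
have [s sP] : exists s : seq {classic I}, forall l (i : {classic I}), z l i != 0 -> i \in s.
  have /choice[s sE] : forall l, exists s : seq {classic I},
      [set i | z l i != 0] = [set` s].
    by move=> l; have /(@finite_seqP {classic I})[s sE] := dsum_fin (z l); exists s.
  exists (flatten [seq s l | l <- enum 'I_k]) => l i zli.
  apply/flattenP; exists (s l); first by apply: map_f; rewrite mem_enum.
  by have : [set` s l] i by rewrite -sE.
elim: s psi psil z sP => [|i s IH] psi psil z sP.
  have nl : linear (fun _ : dsum F => 0 : N) by move=> a x y; rewrite scaler0 addr0.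
  exists (mk_linear nl), (denom1 p) => l.
  have -> : z l = 0.
    by apply: dsumP => i /=; apply/eqP; apply: contrapT => /negP/sP.
  by rewrite linear0 mfrac0 loc_linear0.
have [f0 [r0 f0E]] := fp_loc_linear (Ffp i)
  (loc_linear_comp (mk_linear (@dsum_inj_linear i)) psil).
have [|f1 [r1 f1E]] := IH psi psil (fun l => dsum_cut i (z l)).
  move=> l j /=; rewrite /dsum_cut_fun; case: pselect => [_|ij zj]; first by rewrite eqxx.
  by have := sP l j zj; rewrite inE => /orP[/eqP e|//]; case: ij; rewrite e.
pose h (x : dsum F) : N := den r1 ⋅ f0 (x i) + den r0 ⋅ f1 (dsum_cut i x).
have hl : linear h.
  move=> a x y; rewrite /h (dsum_cut_linear i a x y).
  have -> : (a *: x + y : dsum F) i = a *: x i + y i by [].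
  by rewrite !linearP !scalerDr -!phi_scaleC addrACA.
exists (mk_linear hl), (denomM r0 r1) => l /=.
rewrite [z l in LHS](dsum_cutE i) loc_linearD// (f0E _ : psi (dsum_inj _) = _) f1E.
rewrite mfracD1; congr (_ + _); apply: mfrac_cancel => //=.
by rewrite mulrC.
Qed.

End DirectSums.
End Localization.

(** * Clearing denominators in local splittings *)

Section LocalSplittings.
Variables (R : comPzRingType) (S : pzRingType) (phi : algStr R S).

Local Notation "r ⋅ x" := ((phi r : S^c) *: x) (at level 40, left associativity).

Lemma fp_generators (A : pzRingType) (U : lmodType A) : finitely_presented U ->
  exists n (e : 'I_n -> U), forall x, exists c : 'I_n -> A, x = \sum_i c i *: e i.
Proof.
move=> [_ [n [_ [f [fsurj _]]]]]; exists n, (fun i => f (delta_mx 0 i)) => x.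
have [y <-] := fsurj x; exists (fun i => y 0 i).
by rewrite {1}[y]row_sum_delta linear_sum; apply: eq_bigr => i _; rewrite linearZ.
Qed.

Lemma scaled_linear (U V : rmodType S) (r : R) (f : {linear U -> V}) :
  linear (fun x => r ⋅ f x).
Proof. by move=> a x y; rewrite linearP scalerDr phi_scaleC. Qed.

Definition phi_scale_map (U V : rmodType S) r (f : {linear U -> V}) : {linear U -> V} :=
  mk_linear (scaled_linear r f).

(** The maps out of [N] lift up to a denominator. Those out of [M] need only be right on the
    finitely many images of generators of [N]; there the identities hold after multiplication by a
    further denominator [D]. *)
Lemma local_splits (p : Spec R) (M N : rmodType S) s :
  finitely_presented N -> approximable phi p N M ->
  splits (locMod phi p M) (locMod phi p N) s ->
  exists (F : 'I_s -> {linear M -> N}) (G : 'I_s -> {linear N -> M}) (r : denom p),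
    forall i j x, F i (G j x) = if i == j then den r ⋅ x else 0.
Proof.
move=> Nfp Mapp [F [G FG]].
have /choice[Gr GrE] : forall j, exists Gr : {linear N -> M} * denom p,
    forall x, G j (mfrac phi x (denom1 p)) = mfrac phi (Gr.1 x) Gr.2.
  move=> j; have [g [r gr]] := fp_loc_linear Nfp (loc_linear_mfrac (G j)).
  by exists (g, r).
have [d [c cE]] := common_denom (fun j => (Gr j).2).
pose G' j := phi_scale_map (den (c j)) (Gr j).1.
have G'E j x : G j (mfrac phi x (denom1 p)) = mfrac phi (G' j x) d.
  by rewrite GrE (mfrac_cancel phi _ (cE j)).
have [n [e eP]] := fp_generators Nfp.
have /choice[Fr FrE] : forall i, exists Fr : {linear M -> N} * denom p,
    forall j a, F i (mfrac phi (G' j (e a)) (denom1 p)) =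
                mfrac phi (Fr.1 (G' j (e a))) Fr.2.
  move=> i; pose z (k : 'I_#|{: 'I_s * 'I_n}|) := G' (enum_val k).1 (e (enum_val k).2).
  have [f [r fr]] := Mapp _ (loc_linear_mfrac (F i)) _ z.
  exists (f, r) => j a.
  by have := fr (enum_rank (j, a)); rewrite /z enum_rankK.
have [d' [c' c'E]] := common_denom (fun i => (Fr i).2).
pose F' i := phi_scale_map (den (c' i)) (Fr i).1.
have F'E i j a : F i (mfrac phi (G' j (e a)) (denom1 p)) =
    mfrac phi (F' i (G' j (e a))) d'.
  by rewrite FrE (mfrac_cancel phi _ (c'E i)).
have /choice[w wE] : forall k : 'I_s * 'I_s * 'I_n, exists w : denom p,
    den w ⋅ F' k.1.1 (G' k.1.2 (e k.2)) =
    if k.1.1 == k.1.2 then den w ⋅ (den (denomM d d') ⋅ e k.2) else 0.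
  move=> [[i j] a] /=.
  have : F i (G j (mfrac phi (e a) (denom1 p))) =
      mfrac phi (F' i (G' j (e a))) (denomM d d').
    transitivity (F i ((sfrac phi 1 d : (locRing phi p)^c) *:
        mfrac phi (G' j (e a)) (denom1 p))).
      rewrite G'E scale_mfrac; congr (F i _); apply/mfrac_eq; exists (denom1 p).
      by rewrite /= mulr1 [1 *: _]scale1r.
    by rewrite linearZ /= F'E scale_mfrac [1 *: _]scale1r.
  rewrite FG; case: eqP => _ h.
    have /mfrac_eq[w] := h; rewrite /= mulr1 phi_scaleM => we.
    by exists w; rewrite -we.
  have /mfrac_eq0[w we] := esym h.
  by exists w.
have [D [cw cwE]] := common_denom w.
exists F', (fun j => phi_scale_map (den D) (G' j)), (denomM D (denomM d d')) => i j x.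
have [cx ->] := eP x.
rewrite /= !(linear_sum, scaler_sumr).
have -> : (if i == j then \sum_i0 den D * (den d * den d') ⋅ (cx i0 *: e i0) else 0) =
    \sum_a if i == j then den D * (den d * den d') ⋅ (cx a *: e a) else 0.
  by case: ifP => // _; rewrite big1.
apply: eq_bigr => a _.
have -> : den (c' i) ⋅ (Fr i).1 (den D ⋅ (den (c j) ⋅ (Gr j).1 (cx a *: e a))) =
   cx a *: (den D ⋅ F' i (G' j (e a))).
  transitivity (F' i (phi_scale_map (den D) (G' j) (cx a *: e a))); first by [].
  rewrite [phi_scale_map _ _ _]linearZ [LHS]linearZ; congr (_ *: _).
  exact: linearZ.
rewrite (cwE (i, j, a)) phi_scaleM wE /=; case: ifP => _; last by rewrite !scaler0.
by rewrite -!phi_scaleM -phi_scaleC mulrA.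
Qed.

Lemma locMod_map_linear (p : Spec R) (U V : rmodType S) (f : {linear U -> V}) :
  exists g : {linear locMod phi p U -> locMod phi p V},
    forall x u, g (mfrac phi x u) = mfrac phi (f x) u.
Proof.
pose g (a : locMod phi p U) : locMod phi p V :=
  @loc_rec R p (restr phi U) _ (fun x u => mfrac phi (f x) u) a.
have gE x u : g (mfrac phi x u) = mfrac phi (f x) u.
  apply: loc_recE => {}x {}u y v /mfrac_eq[w e]; apply/mfrac_eq; exists w.
  by rewrite -!linearZ /= e.
have gl : linear g.
  move=> a x y; have [s [t ->]] := sfracP a.
  have [x' [u ->]] := mfracP x; have [y' [v ->]] := mfracP y.
  rewrite scale_mfrac mfracD !gE scale_mfrac mfracD.
  by rewrite linearD !linearZ.
by exists (mk_linear gl).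
Qed.

Lemma splits_local (p : Spec R) (M N : rmodType S) t :
  splits M N t -> splits (locMod phi p M) (locMod phi p N) t.
Proof.
move=> [F [G FG]].
have /choice[F' F'E] := fun i => locMod_map_linear p (F i).
have /choice[G' G'E] := fun j => locMod_map_linear p (G j).
exists F', G' => i j w; have [x [u ->]] := mfracP w.
by rewrite G'E F'E FG; case: ifP => // _; exact: mfrac0.
Qed.

(** A common multiple of denominators killing the finitely many generators kills [N]. *)
Lemma unsupported_annihilator (p : Spec R) (N : rmodType S) :
  finitely_presented N -> ~ Supp (restr phi N) p ->
  exists r, ~ spec_set p r /\ forall x : N, r ⋅ x = 0.
Proof.
move=> Nfp pN; have [n [e eP]] := fp_generators Nfp.
have /choice[w wE] : forall i, exists w : denom p, den w ⋅ e i = 0.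
  move=> i; apply/(mfrac_eq0 phi _ (denom1 p)); apply: contrapT => /eqP ei.
  by apply: pN; exists (mfrac phi (e i) (denom1 p)).
have [d [c cE]] := common_denom w.
exists (den d); split=> [|x]; first exact: denomP.
have [a ->] := eP x; rewrite scaler_sumr big1// => i _.
by rewrite phi_scaleC (cE i) phi_scaleM wE !scaler0.
Qed.

End LocalSplittings.

(** * From local to global splittings *)

Section GlobalSplittings.
Variables (R : comPzRingType) (S : pzRingType) (phi : algStr R S).
Hypothesis S_module_finite : finitely_generated (algMod phi).
Variables (M N : rmodType S).
Hypothesis N_fp : finitely_presented N.
Hypothesis M_approx : forall p, approximable phi p N M.

Let Y : set (Spec R) := Max R `&` Supp (restr phi N).
Hypothesis noethY : noetherian_space Y.

Let iota := endo_alg phi N.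
Let pt (x : Y) : set R := spec_set (set_val x).

Let ptmax x : is_maximal_ideal (pt x).
Proof. by case: (set_valP x). Qed.

Lemma Spec_inj (p q : Spec R) : spec_set p = spec_set q -> p = q.
Proof.
case: p q => [p hp] [q hq] /= pq; subst q; congr MkSpec; exact: Prop_irrelevance.
Qed.

Let ptinj : injective pt.
Proof. by move=> x y /Spec_inj/val_inj. Qed.

Let ptclosed r : closed [set x : Y | pt x r].
Proof.
have -> : [set x : Y | pt x r] = set_val @^-1` (zariski_V [set r]).
  by apply/seteqP; split=> x /= h; [move=> _ ->|exact: h].
apply: closed_comp; first by move=> x _; exact: initial_continuous.
by rewrite -[zariski_V _]setCK; apply: open_closedC; exists [set r].
Qed.

Fact endo_comp_linear (f : {linear M -> N}) (g : {linear N -> M}) :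
  linear (fun x => f (g x)).
Proof. by move=> a x y; rewrite !linearP. Qed.

Definition endo_comp (f : {linear M -> N}) (g : {linear N -> M}) : endo N :=
  Endo (endo_comp_linear f g).

Definition comp_mx p q (F : 'I_p -> {linear M -> N}) (G : 'I_q -> {linear N -> M}) :
  'M[endo N]_(p, q) := \matrix_(i, j) endo_comp (F i) (G j).

Definition fam_cat (T : Type) p q (f : 'I_p -> T) (g : 'I_q -> T) (i : 'I_(p + q)) : T :=
  match fintype.split i with inl k => f k | inr k => g k end.

Lemma comp_mx_cat p p' q q' (F : 'I_p -> {linear M -> N}) (F' : 'I_p' -> {linear M -> N})
  (G : 'I_q -> {linear N -> M}) (G' : 'I_q' -> {linear N -> M}) :
  comp_mx (fam_cat F F') (fam_cat G G') =
  block_mx (comp_mx F G) (comp_mx F G') (comp_mx F' G) (comp_mx F' G').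
Proof.
apply/matrixP => i j; rewrite !mxE /fam_cat.
by case: (fintype.split i) => k; rewrite !mxE; case: (fintype.split j) => l; rewrite !mxE.
Qed.

Lemma comp_mx_splits p q t (F : 'I_p -> {linear M -> N}) (G : 'I_q -> {linear N -> M})
    (A : 'M_(t, p)) (D : 'M_(q, t)) :
  A *m comp_mx F G *m D = 1%:M -> splits M N t.
Proof.
move=> AD.
have Fl i : linear (fun x => \sum_k A i k (F k x)).
  move=> a x y; rewrite scaler_sumr -big_split; apply: eq_bigr => k _ /=.
  by rewrite !linearP.
have Gl j : linear (fun x => \sum_l G l (D l j x)).
  move=> a x y; rewrite scaler_sumr -big_split; apply: eq_bigr => l _ /=.
  by rewrite !linearP.
exists (fun i => mk_linear (Fl i)), (fun j => mk_linear (Gl j)) => i j x /=.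
have ADx := congr1 (fun X : 'M[endo N]_t => X i j x) AD.
move: ADx; rewrite [1%:M i j]mxE => ADx.
transitivity (((i == j)%:R : endo N) x); last first.
  by case: eqP => _; rewrite ?mulr1n ?mulr0n.
rewrite -ADx mxE endo_sumE.
transitivity (\sum_l \sum_k A i k (F k (G l (D l j x)))).
  rewrite exchange_big; apply: eq_bigr => k _; rewrite !linear_sum.
  by apply: eq_bigr => l _.
apply: eq_bigr => l _; rewrite mxE.
transitivity ((\sum_k A i k * comp_mx F G k l) (D l j x)); last by [].
rewrite endo_sumE.
by apply: eq_bigr => k _; rewrite mxE.
Qed.

(** Noetherian induction on a closed subset [Z]: a local splitting at a point of [Z] works wherever
    its scalar [r] is invertible. The smaller closed set where [r] vanishes is covered by induction,
    and the families are concatenated. *)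
Lemma global_comp_mx s :
  (forall m, Y m -> splits (locMod phi m M) (locMod phi m N) s) ->
  exists p q (F : 'I_p -> {linear M -> N}) (G : 'I_q -> {linear N -> M}),
    forall x, mx_rank_at iota (pt x) (comp_mx F G) s.
Proof.
move=> Ys.
suff [p [q [F [G FG]]]] : exists p q (F : 'I_p -> {linear M -> N})
    (G : 'I_q -> {linear N -> M}), forall x, [set: Y] x ->
      mx_rank_at iota (pt x) (comp_mx F G) s.
  by exists p, q, F, G => x; exact: FG.
move: [set: Y] (@closedT Y); apply: noetherian_ind => // Z cZ IH.
have [->|/set0P[x Zx]] := eqVneq Z set0.
  have f (T : Type) : 'I_0 -> T by case.
  by exists 0%N, 0%N, (f _), (f _).
have Yx : Y (set_val x) := set_valP x.
have [F1 [G1 [r FG1]]] := local_splits N_fp (M_approx (p := _)) (Ys _ Yx).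
have FG1E : comp_mx F1 G1 = cmx iota s (den r).
  apply/matrixP => i j; rewrite !mxE; apply: endoP => y /=; rewrite FG1.
  by case: eqP => _; rewrite ?mulr1n ?mulr0n.
have [||p [q [F0 [G0 FG0]]]] := IH (Z `&` [set y | pt y (den r)]).
- exact: closedI.
- split=> [y []//|ZZ]; have [_ /=] := ZZ _ Zx; exact: denomP.
exists (p + s)%N, (q + s)%N, (fam_cat F0 F1), (fam_cat G0 G1) => y Zy.
rewrite comp_mx_cat; have [yr|yr] := pselect (pt y (den r)).
  have [C [D [a [ya CD]]]] := FG0 y (conj Zy yr).
  exists (row_mx C 0), (col_mx D 0), a; split=> //.
  by rewrite mul_row_block mul_row_col !mul0mx mulmx0 !addr0.
exists (row_mx 0 1%:M), (col_mx 0 1%:M), (den r); split=> //.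
by rewrite mul_row_block mul_row_col !mul0mx mulmx0 !add0r FG1E mul1mx mulmx1.
Qed.

Lemma global_splits t d : dimlt [set: Y] d.+1 ->
  (forall m, Y m -> splits (locMod phi m M) (locMod phi m N) (t + d)) ->
  splits M N t.
Proof.
move=> Yd Ys; have [p [q [F [G FG]]]] := global_comp_mx Ys.
have [|A [D AD]] := @mx_split _ _ iota _ (endo_mod_fg S_module_finite N_fp)
   (@endo_mod_faithful _ N) _ _ noethY ptmax ptinj ptclosed t d _ _ (comp_mx F G) Yd FG.
(* A maximal ideal outside [Y] is not in the support of [N], so some scalar outside it acts as
   zero. *)
- move=> m mmax nm; pose P := MkSpec (maximal_ideal_prime mmax).
  have [|r [mr rN]] := @unsupported_annihilator _ _ phi P N N_fp.
    move=> PN; apply: nm.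
    have YP : Y P by [].
    by exists (exist _ P (mem_set YP)).
  by exists r; split=> //; apply: endoP => x; exact: rN.
- exact: comp_mx_splits AD.
Qed.

End GlobalSplittings.

(** * Deduction of the three statements on suprema *)

Lemma infimum_attained (A : set (\bar int)) y :
  A y -> (forall x, A x -> (y <= x)%E) -> infimum +oo%E A = y.
Proof.
move=> Ay yA; rewrite /infimum; case: eqP => [A0|_]; first by move: Ay; rewrite A0.
by apply: xget_subset1; [split=> // z; apply|exact: is_subset1_infimums].
Qed.

Theorem theorem0p5 (R : comPzRingType) (S : pzRingType) (phi : algStr R S)
  (S_module_finite : finitely_generated (algMod phi))
  (M N : rmodType S)
  (M_summand : exists (I : Type) (F : I -> rmodType S),
     (forall i, finitely_presented (F i)) /\ direct_summand M (dsum F))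
  (N_fp : finitely_presented N) :
  let Y : set (Spec R) := Max R `&` Supp (restr phi N) in
  let splloc (m : Spec R) : \bar int :=
    spl (locMod phi m M) (locMod phi m N) in
  noetherian_space Y ->
  (krull_dim Y < +oo)%E ->
  [/\ (forall t : nat, (0 < t)%N ->
        (forall m, Y m -> (t%:Z%:E + krull_dim Y <= splloc m)%E) ->
        (t%:Z%:E <= spl M N)%E),
      (spl M N = +oo%E <-> forall m, Y m -> splloc m = +oo%E) &
      ((exists n, Y n /\ (splloc n < +oo)%E) ->
        (infimum +oo [set splloc m | m in Y] - krull_dim Y <= spl M N)%E)].
Proof.
move=> Y splloc noethY dimY.
have Mapp p : approximable phi p N M.
  have [I [F [Ffp MF]]] := M_summand.
  exact: approximable_summand MF (approximable_dsum Ffp).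
have splitsM t d : dimlt [set: Y] d.+1 ->
    (forall m, Y m -> ((t + d)%N%:Z%:E <= splloc m)%E) -> splits M N t.
  move=> Yd Ys; apply: (global_splits S_module_finite N_fp Mapp noethY Yd).
  by move=> m Ym; apply/le_spl; exact: Ys.
have [d dP] : exists d, dimlt [set: Y] d.+1 /\ (Y !=set0 -> krull_dim Y = d%:Z%:E).
  have [[m Ym]|Y0] := pselect (Y !=set0).
    have [d [dE Yd]] := krull_dim_dimlt dimY (exist _ m (mem_set Ym)).
    by exists d.
  (* For empty [Y] the Krull dimension is -oo, and d = 0 serves since there are no chains. *)
  exists 0%N; split=> // -[C [[Ccl _] _]]; apply: Y0.
  have [_ [[x _] _]] := Ccl 0%N isT.
  by exists (set_val x); exact: set_valP.
have [Yd dE] := dP.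
split.
- move=> t _ Ys; apply/le_spl; apply: (splitsM t d Yd) => m Ym.
  have := Ys m Ym; rewrite dE; last by exists m.
  by rewrite PoszD.
- split=> [/spl_pinfty sp m _|Ys]; apply/spl_pinfty => t.
    by apply: splits_local; exact: sp.
  by apply: (splitsM t d Yd) => m /Ys ->; rewrite leey.
- move=> [n [Yn nfin]].
  have [k0 k0E] : exists k : nat, splloc n = k%:Z%:E.
    by have [//|e] := spl_nat_or_pinfty (locMod phi n M) (locMod phi n N); rewrite /splloc e in nfin.
  (* The finite value at [n] makes the infimum a minimum [k] of natural numbers. *)
  have exP : exists k, `[< exists m, Y m /\ splloc m = k%:Z%:E >].
    by exists k0; apply/asboolP; exists n.
  case: (ex_minnP exP) => k /asboolP[m [Ym mk]] kmin.
  have kle m' : Y m' -> (k%:Z%:E <= splloc m')%E.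
    move=> Ym'; have [[l lE]|lE] := spl_nat_or_pinfty (locMod phi m' M) (locMod phi m' N).
      by rewrite /splloc lE lee_fin lez_nat kmin//; apply/asboolP; exists m'.
    by rewrite /splloc lE leey.
  rewrite dE; last by exists n.
  rewrite (@infimum_attained _ k%:Z%:E); first last.
  + by move=> _ [m' Ym' <-]; exact: kle.
  + by exists m.
  (* If k <= d, the bound is at most 0 and the empty splitting suffices. *)
  have [kd|dk] := leqP k d.
    apply: (@le_trans _ _ 0%:Z%:E); first by rewrite lee_fin lerBlDr add0r lez_nat.
    by apply/le_spl; exact: splits0.
  rewrite -EFinB subzn ?(ltnW dk)//; apply/le_spl/(splitsM _ d Yd) => m' Ym'.
  by rewrite subnK ?(ltnW dk)//; exact: kle.
Qed.
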